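(* Let $\mathcal{H}$ be a complex Hilbert space and let $(\mathcal{T}_t)_{t\ge 0}$ be a uniformly continuous quantum dynamical semigroup on $\mathfrak{B}(\mathcal{H})$ of the form $\mathcal{T}_t(X)=\mathbb{E}_{0]}[U_t^\dagger(X\otimes \mathbb{1})U_t]$, whose set of invariant density operators $\mathcal{C}_\ast$ is a non-empty proper subset of $\mathfrak{S}(\mathcal{H})$. Then $\mathcal{C}_\ast$ is globally asymptotically stable if and only if it is locally asymptotically stable.
   Context: Notation. $\mathfrak{B}(\mathcal{H})$ is the algebra of bounded operators on $\mathcal{H}$; $\mathfrak{I}_1(\mathcal{H})$ is the space of trace-class operators with norm $\|X\|_1=\operatorname{tr}\sqrt{X^\ast X}$; $\mathfrak{S}(\mathcal{H})\subset \mathfrak{I}_1(\mathcal{H})$ is the set of density operators (non-negative, trace one). For $\sigma\in\mathfrak{S}(\mathcal{H})$, $d(\sigma,\mathcal{C}_\ast)=\inf_{\rho\in\mathcal{C}_\ast}\|\sigma-\rho\|_1$. Quantum dynamical semigroup. A quantum dynamical semigroup (QDS) on $\mathfrak{B}(\mathcal{H})$ is a family of bounded linear maps $\mathcal{T}_t$, $t\ge 0$, with $\mathcal{T}_0=\mathrm{id}$, $\mathcal{T}_{s+t}=\mathcal{T}_s\circ\mathcal{T}_t$, each $\mathcal{T}_t$ completely positive and normally ($\sigma$-weakly) continuous. Here $U_t$ are the unitaries on $\mathcal{H}\otimes\Gamma$ describing the joint evolution of the system and an environment with Fock space $\Gamma$ in the state $\Psi\in\mathfrak{S}(\Gamma)$,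 and $\mathbb{E}_{0]}$ is the conditional expectation onto the system, so $\operatorname{tr}(\rho\,\mathbb{E}_{0]}[Z])=\operatorname{tr}((\rho\otimes\Psi)Z)$; in particular $\mathcal{T}_t(\mathbb{1})=\mathbb{1}$. The predual semigroup on $\mathfrak{I}_1(\mathcal{H})$ is $\mathcal{S}_t(\rho)=\operatorname{tr}_\Gamma(U_t(\rho\otimes\Psi)U_t^\dagger)$, and $\operatorname{tr}(\rho\,\mathcal{T}_t(X))=\operatorname{tr}(\mathcal{S}_t(\rho)X)$. Uniform continuity means norm continuity of $t\mapsto\mathcal{T}_t$, so its generator is bounded. A density operator $\rho$ is invariant if $\operatorname{tr}(\rho\,\mathcal{T}_t(A))=\operatorname{tr}(\rho A)$ for all $A\in\mathfrak{B}(\mathcal{H})$, $t\ge0$. Stability notions. Let $\mathcal{N}\subseteq\mathfrak{S}(\mathcal{H})$ be a neighborhood of $\mathcal{C}_\ast$, strictly containing $\mathcal{C}_\ast$: a union of closed balls $\{\rho\in\mathfrak{S}(\mathcal{H}):\|\rho-\rho_0\|_1\le\epsilon_0\}$ that contains, for some $\epsilon>0$, all the balls $\{\rho\in\mathfrak{S}(\mathcal{H}):\|\rho-\rho_\ast\|_1\le\epsilon\}$ with $\rho_\ast\in\mathcal{C}_\ast$. For initial density operators $\rho\in\mathcal{N}$ write $\rho_t=\mathcal{S}_t(\rho)$. - $\mathcal{C}_\ast$ is Lyapunov stable if for every $\varepsilon>0$ there is $\delta(\varepsilon)>0$ such that $d(\rho,\mathcal{C}_\ast)<\delta(\varepsilon)$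 implies $d(\rho_t,\mathcal{C}_\ast)<\varepsilon$ for all $t\ge0$. - $\mathcal{C}_\ast$ is locally asymptotically stable if it is Lyapunov stable and there is $\delta>0$ such that $d(\rho,\mathcal{C}_\ast)<\delta$ implies $\lim_{t\to\infty}d(\rho_t,\mathcal{C}_\ast)=0$. - $\mathcal{C}_\ast$ is globally asymptotically stable if the preceding holds with $\mathcal{N}=\mathfrak{S}(\mathcal{H})$ and $\delta$ arbitrary, i.e. it is Lyapunov stable and $\lim_{t\to\infty}d(\rho_t,\mathcal{C}_\ast)=0$ for every $\rho\in\mathfrak{S}(\mathcal{H})$. *)

(* Defs.v *)
From HB Require Import structures.
From mathcomp Require Import all_boot all_order all_fingroup all_algebra complex.
From mathcomp Require Import all_classical all_reals all_analysis.
From mathcomp.analysis.showcase Require Import summability.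
Import Order.TTheory GRing.Theory Num.Theory numFieldNormedType.Exports.

Set Implicit Arguments.
Unset Strict Implicit.
Unset Printing Implicit Defensive.

Local Open Scope classical_set_scope.
Local Open Scope ring_scope.

(* The inner product [hdot H] is linear in its FIRST argument and
   conjugate-linear in the second. *)
Record hilbert (R : realType) := Hilbert {
  hcarrier :> completeNormedModType R[i];
  hdot : {dot hcarrier for Num.Def.conjC};
  hdotxx : forall u : hcarrier, hdot u u = `|u| ^+ 2 }.
Arguments hdot {R} h : rename.

Section Operators.
Context {R : realType}.
Implicit Types H : hilbert R.

(* The norm of a normed module over R[i] takes its values in R[i]. *)
Definition hnorm {H} (u : H) : R := complex.Re `|u|.

Definition lspan {H} (S : set H) : set H :=
  [set v | exists (n : nat) (a : 'I_n -> R[i]) (s : 'I_n -> H),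
     (forall i, S (s i)) /\ v = \sum_(i < n) a i *: s i].

Definition orthonormal_basis {H} (E : set H) : Prop :=
  [/\ forall e, E e -> hdot H e e = 1,
      forall e f, E e -> E f -> e <> f -> hdot H e f = 0
    & dense (lspan E)].

(* The Hilbert space need not be separable: the basis is a set of arbitrary
   cardinality.  On positive and on trace-class operators the traces below do
   not depend on the basis that is picked here. *)
Definition hbasis H : set H := get (@orthonormal_basis H).
Arguments hbasis H : clear implicits.

(* Operators are everywhere-defined functions, so that sums, differences and
   scalar multiples are the pointwise ones; [bounded_op] carves out B(H). *)
Definition op H := H -> H.

Definition bounded_op {H} (A : op H) : Prop :=
  (forall (a : R[i]) (u v : H), A (a *: u + v) = a *: A u + A v) /\
  exists M : R, forall u, hnorm (A u) <= M * hnorm u.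

Definition opnorm {H} (A : op H) : R :=
  sup [set hnorm (A u) | u in [set u | hnorm u <= 1]].

Definition adj {H} (A : op H) : op H :=
  get [set B : op H | bounded_op B /\
                      forall u v, hdot H (A u) v = hdot H u (B v)].

(* [0 <= z] in R[i] says that z is real and nonnegative. *)
Definition psd {H} (A : op H) : Prop := forall u, 0 <= hdot H (A u) u.

Definition opsqrt {H} (A : op H) : op H :=
  get [set B : op H | [/\ bounded_op B, psd B & B \o B = A]].

Definition opabs {H} (A : op H) : op H := opsqrt (adj A \o A).

Definition unitary {H} (U : op H) : Prop :=
  [/\ bounded_op U, adj U \o U = id & U \o adj U = id].

(* Trace of a positive operator, possibly +oo. *)
Definition etr {H} (A : op H) : \bar R :=
  (\esum_(e in hbasis H) (complex.Re (hdot H (A e) e))%:E)%E.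

Definition trace_class {H} (A : op H) : Prop :=
  bounded_op A /\ (etr (opabs A) < +oo)%E.

Definition trnorm {H} (A : op H) : R := fine (etr (opabs A)).

(* [sum] is the unordered sum, i.e. the limit along finite subsets. *)
Definition tr {H} (A : op H) : R[i] :=
  sum (fun e : hbasis H => hdot H (A (set_val e)) (set_val e) : R[i]^o).

Definition density {H} : set (op H) :=
  [set rho | [/\ trace_class rho, psd rho & tr rho = 1]].

(* Positivity of the operator matrix (A_ij) on H^n. *)
Definition psd_mx {H} (n : nat) (A : 'I_n -> 'I_n -> op H) : Prop :=
  forall u : 'I_n -> H, 0 <= \sum_(i < n) \sum_(j < n) hdot H (A i j (u j)) (u i).

Definition completely_positive {H} (T : op H -> op H) : Prop :=
  forall (n : nat) (A : 'I_n -> 'I_n -> op H),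
    (forall i j, bounded_op (A i j)) -> psd_mx A ->
    psd_mx (fun i j => T (A i j)).

(* Convergence of a filter on B(H) in the sigma-weak topology, the initial
   topology of the functionals Y |-> tr (rho Y), rho trace class. *)
Definition sigma_weak_cvg {H} (F : set_system (op H)) (X : op H) : Prop :=
  forall rho : op H, trace_class rho ->
    (fun Y : op H => tr (rho \o Y) : R[i]^o) @ F --> (tr (rho \o X) : R[i]^o).

Definition sigma_weakly_continuous {H} (T : op H -> op H) : Prop :=
  forall (X : op H) (F : set_system (op H)),
    bounded_op X -> ProperFilter F -> F bounded_op ->
    sigma_weak_cvg F X -> sigma_weak_cvg (T @ F) (T X).

Definition bounded_superop {H} (T : op H -> op H) : Prop :=
  [/\ forall X, bounded_op X -> bounded_op (T X),
      forall (a : R[i]) X Y, bounded_op X -> bounded_op Y ->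
        T (a *: X + Y) = a *: T X + T Y
    & exists M : R, forall X, bounded_op X -> opnorm (T X) <= M * opnorm X].

Definition superopnorm {H} (T : op H -> op H) : R :=
  sup [set opnorm (T X) | X in [set X | bounded_op X /\ opnorm X <= 1]].

(* Time is [t : R] with [0 <= t]; the values at negative times are junk. *)
Record qds {H} (T : R -> op H -> op H) : Prop := Qds {
  qds_bounded : forall t, 0 <= t -> bounded_superop (T t);
  qds_0 : forall X, bounded_op X -> T 0 X = X;
  qds_D : forall s t X, 0 <= s -> 0 <= t -> bounded_op X ->
    T (s + t) X = T s (T t X);
  qds_cp : forall t, 0 <= t -> completely_positive (T t);
  qds_normal : forall t, 0 <= t -> sigma_weakly_continuous (T t) }.

Definition uniformly_continuous_sg {H} (T : R -> op H -> op H) : Prop :=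
  forall t, 0 <= t ->
    superopnorm (fun X => T s X - T t X)
      @[s --> within [set s | 0 <= s] (nbhs t)] --> (0 : R).

End Operators.

Record tensor_product {R : realType} (H G : hilbert R) := TensorProduct {
  tp_space :> hilbert R;
  tp_mul : {bilinear H -> G -> tp_space};
  tp_dot : forall (a c : H) (b d : G),
    hdot tp_space (tp_mul a b) (tp_mul c d) = hdot H a c * hdot G b d;
  tp_dense : dense (lspan [set v | exists a b, v = tp_mul a b]) }.
Arguments tp_mul {R H G} t : rename.

(* Fock space over the one-particle space K, as the Hilbert space spanned by
   the n-particle vectors f_1 ... f_n (n >= 0; n = 0 gives the vacuum), with
   different particle numbers orthogonal, and with the permanent (symmetric,
   Bose), the determinant (antisymmetric, Fermi) or the plain product (full)
   of the <f_i, g_j> as inner product of two n-particle vectors. *)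
Inductive statistics := Bose | Fermi | Boltzmann.

Definition stat_weight {R : realType} (st : statistics) (n : nat)
    (s : 'S_n) : R[i] :=
  match st with
  | Bose => 1
  | Fermi => (-1) ^+ s
  | Boltzmann => (s == 1%g)%:R
  end.

Record fock_space {R : realType} (st : statistics) (K : hilbert R) :=
  FockSpace {
  fock_carrier :> hilbert R;
  fock_vec : forall n : nat, ('I_n -> K) -> fock_carrier;
  fock_dot : forall (n : nat) (f g : 'I_n -> K),
    hdot fock_carrier (fock_vec f) (fock_vec g) =
    \sum_(s : 'S_n) stat_weight st s * \prod_(i < n) hdot K (f i) (g (s i));
  fock_orth : forall (m n : nat) (f : 'I_m -> K) (g : 'I_n -> K), m <> n ->
    hdot fock_carrier (fock_vec f) (fock_vec g) = 0;
  fock_dense : dense (lspan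
    [set v | exists (n : nat) (f : 'I_n -> K), v = fock_vec f]) }.

Section OpenSystem.
Context {R : realType} {H G : hilbert R} (P : tensor_product H G).

Definition optensor (A : op H) (B : op G) : op P :=
  get [set Z : op P | bounded_op Z /\
        forall a b, Z (tp_mul P a b) = tp_mul P (A a) (B b)].

(* E0 is determined by this condition, and so is the partial trace trG (on
   trace-class operators) by the next one. *)
Definition conditional_expectation (Psi : op G) (E0 : op P -> op H) : Prop :=
  forall Z : op P, bounded_op Z -> bounded_op (E0 Z) /\
    forall rho : op H, trace_class rho ->
      tr (rho \o E0 Z) = tr (optensor rho Psi \o Z).

Definition partial_trace (trG : op P -> op H) : Prop :=
  forall W : op P, trace_class W -> trace_class (trG W) /\
    forall X : op H, bounded_op X ->
      tr (trG W \o X) = tr (W \o optensor X id).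

Definition predual_sg (trG : op P -> op H) (U : R -> op P) (Psi : op G)
    (t : R) (rho : op H) : op H :=
  trG (U t \o optensor rho Psi \o adj (U t)).

End OpenSystem.
Arguments optensor {R H G} P A B.
Arguments conditional_expectation {R H G P} Psi E0.
Arguments partial_trace {R H G P} trG.

Section Stability.
Context {R : realType} {H : hilbert R}.
Implicit Types (S : R -> op H -> op H) (C N : set (op H)).

Definition invariant_densities (T : R -> op H -> op H) : set (op H) :=
  [set rho | density rho /\ forall (A : op H) t, bounded_op A -> 0 <= t ->
    tr (rho \o T t A) = tr (rho \o A)].

Definition dist (sigma : op H) C : R := inf [set trnorm (sigma - rho) | rho in C].

Definition density_ball (rho0 : op H) (e : R) : set (op H) :=
  [set rho | density rho /\ trnorm (rho - rho0) <= e].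

(* The neighbourhood is a union of closed balls whose centers and positive
   radii may vary. *)
Definition density_nbhd C N : Prop :=
  [/\ C `<` N,
      exists B : set (op H * R),
        (forall b, B b -> density b.1 /\ 0 < b.2) /\
        N = \bigcup_(b in B) density_ball b.1 b.2
    & exists2 e : R, 0 < e & forall rho, C rho -> density_ball rho e `<=` N].

Definition lyapunov_stable S N C : Prop :=
  forall e : R, 0 < e -> exists2 d : R, 0 < d &
    forall rho, N rho -> dist rho C < d ->
      forall t, 0 <= t -> dist (S t rho) C < e.

Definition locally_asymptotically_stable S N C : Prop :=
  lyapunov_stable S N C /\
  exists2 d : R, 0 < d & forall rho, N rho -> dist rho C < d ->
    dist (S t rho) C @[t --> +oo] --> (0 : R).

Definition globally_asymptotically_stable S C : Prop :=
  lyapunov_stable S density C /\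
  forall rho, density rho -> dist (S t rho) C @[t --> +oo] --> (0 : R).

End Stability.

(* Main.v *)
Require Import Defs.
From mathcomp Require Import all_boot all_order all_fingroup all_algebra complex.
From mathcomp Require Import all_classical all_reals all_analysis.
From mathcomp Require Import finmap ring lra.
From mathcomp.analysis.showcase Require Import summability.
Import Order.TTheory GRing.Theory Num.Theory numFieldNormedType.Exports.
Local Open Scope classical_set_scope.
Local Open Scope ring_scope.

(** Stability in a neighborhood propagates to all states along segments.  Join an invariant
   density operator to an arbitrary one by a segment and subdivide it into n steps: the
   predual maps are affine and preserve density operators, so the trajectories of
   consecutive points stay within 2/n in trace norm at all times.  Once the first
   trajectory has come close to the invariant set, the second one is in the basin given by
   local stability, and the semigroup property makes it converge as well.

   The triangle inequality for the trace norm rests on tr |X| <= tr D whenever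
   -D <= X <= D; all traces are reduced to Hilbert-Schmidt norms by polarization. *)

Set Implicit Arguments.
Unset Strict Implicit.
Unset Printing Implicit Defensive.

(** The predual maps come with little structure: [trG] is known only through a trace identity on
    trace-class operators, and no composition law is given for the [U t]. Affinity and the semigroup
    property are therefore transported from [T] by duality, using that a positive operator is
    determined by its traces against rank-one operators. The duality itself is the delicate point:
    [tr] is an unordered sum with a default value when it diverges, so each trace needs a proof of
    convergence before the unitaries can be moved from the state to the observable. Writing a state
    as C C with C Hilbert-Schmidt settles both: convergence comes from finite Hilbert-Schmidt norms,
    and their invariance under adjoints and unitaries stands in for the cyclicity of the trace. Only
    differences of density operators enter the distances, so the triangle inequality is needed for
    self-adjoint operators alone. *)

Section ComplexFacts.
Variable R : realType.
Implicit Types x y : R[i].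

Lemma complex_ext x y : complex.Re x = complex.Re y -> complex.Im x = complex.Im y -> x = y.
Proof. by case: x y => a b [c d] /= -> ->. Qed.

Lemma complex_ge0 x : (0 <= x) = (complex.Im x == 0) && (0 <= complex.Re x).
Proof. by rewrite lecE. Qed.

Lemma Re_add x y : complex.Re (x + y) = complex.Re x + complex.Re y.
Proof. by case: x y => a b []. Qed.
Lemma Im_add x y : complex.Im (x + y) = complex.Im x + complex.Im y.
Proof. by case: x y => a b []. Qed.
Lemma Re_opp x : complex.Re (- x) = - complex.Re x.
Proof. by case: x. Qed.
Lemma Im_opp x : complex.Im (- x) = - complex.Im x.
Proof. by case: x. Qed.
Lemma Re_conj x : complex.Re (Num.conj x) = complex.Re x.
Proof. by case: x. Qed.
Lemma Im_conj x : complex.Im (Num.conj x) = - complex.Im x.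
Proof. by case: x. Qed.
Lemma Re_mul x y : complex.Re (x * y) = complex.Re x * complex.Re y - complex.Im x * complex.Im y.
Proof. by case: x y => a b []. Qed.
Lemma Im_mul x y : complex.Im (x * y) = complex.Re x * complex.Im y + complex.Im x * complex.Re y.
Proof. by case: x y => a b []. Qed.

Lemma Re_sum I (r : seq I) (P : pred I) (F : I -> R[i]) :
  complex.Re (\sum_(i <- r | P i) F i) = \sum_(i <- r | P i) complex.Re (F i).
Proof. exact: (big_morph _ Re_add (erefl _)). Qed.

End ComplexFacts.

(** * Inner products *)

Section InnerProduct.
Variables (R : realType) (H : hilbert R).
Implicit Types (u v w : H) (r : R) (a : R[i]).

Definition ip u v : R := complex.Re (hdot H u v).

Lemma hdotC u v : hdot H u v = Num.conj (hdot H v u).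
Proof. by rewrite (@hermC _ false) expr0 mul1r. Qed.

Lemma hdotDl u v w : hdot H (u + v) w = hdot H u w + hdot H v w.
Proof. exact: linearDl. Qed.
Lemma hdotDr u v w : hdot H w (u + v) = hdot H w u + hdot H w v.
Proof. exact: linearDr. Qed.
Lemma hdotZl a u v : hdot H (a *: u) v = a * hdot H u v.
Proof. exact: linearZl_LR. Qed.
Lemma hdotZr a u v : hdot H u (a *: v) = Num.conj a * hdot H u v.
Proof. exact: linearZr_LR. Qed.
Lemma hdot0l u : hdot H 0 u = 0.
Proof. exact: linear0l. Qed.
Lemma hdot0r u : hdot H u 0 = 0.
Proof. exact: linear0r. Qed.
Lemma hdotNl u v : hdot H (- u) v = - hdot H u v.
Proof. exact: linearNl. Qed.
Lemma hdotNr u v : hdot H u (- v) = - hdot H u v.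
Proof. exact: linearNr. Qed.
Lemma hdotBl u v w : hdot H (u - v) w = hdot H u w - hdot H v w.
Proof. exact: linearBl. Qed.
Lemma hdotBr u v w : hdot H w (u - v) = hdot H w u - hdot H w v.
Proof. exact: linearBr. Qed.

Lemma ipC u v : ip u v = ip v u.
Proof. by rewrite /ip hdotC Re_conj. Qed.
Lemma ipDl u v w : ip (u + v) w = ip u w + ip v w.
Proof. by rewrite /ip hdotDl Re_add. Qed.
Lemma ipDr u v w : ip w (u + v) = ip w u + ip w v.
Proof. by rewrite /ip hdotDr Re_add. Qed.
Lemma ipNl u v : ip (- u) v = - ip u v.
Proof. by rewrite /ip hdotNl Re_opp. Qed.
Lemma ipNr u v : ip u (- v) = - ip u v.
Proof. by rewrite /ip hdotNr Re_opp. Qed.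
Lemma ipZl r u v : ip (r%:C%C *: u) v = r * ip u v.
Proof. by rewrite /ip hdotZl Re_mul /= mul0r subr0. Qed.
Lemma ipZr r u v : ip u (r%:C%C *: v) = r * ip u v.
Proof. by rewrite ipC ipZl ipC. Qed.
Lemma ip0l u : ip 0 u = 0.
Proof. by rewrite /ip hdot0l. Qed.
Lemma ip0r u : ip u 0 = 0.
Proof. by rewrite /ip hdot0r. Qed.

Lemma ipil u v : ip ('i%C *: u) v = - ip u ('i%C *: v).
Proof.
rewrite /ip hdotZl hdotZr !Re_mul Re_conj Im_conj /=; ring.
Qed.
Lemma ipii u v : ip ('i%C *: u) ('i%C *: v) = ip u v.
Proof.
rewrite /ip hdotZl hdotZr !(Re_mul,Im_mul) Re_conj Im_conj /=; ring.
Qed.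
Lemma ipi0 u : ip u ('i%C *: u) = 0.
Proof. have := ipil u u; rewrite ipC; lra. Qed.

(** Conjugate-linearity in the second argument makes Re <u, i v> the imaginary part of <u, v>, so
    most computations can be done with the real form [ip]. *)
Lemma hdotE u v : hdot H u v = Complex (ip u v) (ip u ('i%C *: v)).
Proof.
apply: complex_ext => //=.
rewrite /ip hdotZr Re_mul Re_conj Im_conj /=; ring.
Qed.

Lemma hdot_uu u : hdot H u u = (ip u u)%:C%C.
Proof. by rewrite hdotE ipi0. Qed.

Lemma normE u : `|u| = (hnorm u)%:C%C.
Proof. by rewrite /hnorm RRe_real // ger0_real. Qed.

Lemma hnorm_ge0 u : 0 <= hnorm u.
Proof. by have := normr_ge0 u; rewrite normE ler0c. Qed.

Lemma ipuu u : ip u u = hnorm u ^+ 2.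
Proof. by rewrite /ip hdotxx normE -rmorphXn. Qed.

Lemma ip_ge0 u : 0 <= ip u u.
Proof. by rewrite ipuu exprn_ge0 // hnorm_ge0. Qed.

Lemma hnorm_eq0 u : hnorm u = 0 -> u = 0.
Proof. by move=> h; apply/eqP; rewrite -normr_eq0 normE h. Qed.

Lemma ip_eq0 u : ip u u = 0 -> u = 0.
Proof. by rewrite ipuu => /eqP; rewrite sqrf_eq0 => /eqP; apply: hnorm_eq0. Qed.

Lemma hnorm0 : hnorm (0 : H) = 0.
Proof. by rewrite /hnorm normr0. Qed.

Lemma hnormN u : hnorm (- u) = hnorm u.
Proof. by rewrite /hnorm normrN. Qed.

Lemma ler_hnormD u v : hnorm (u + v) <= hnorm u + hnorm v.
Proof. by have := ler_normD u v; rewrite !normE -rmorphD lecR. Qed.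

Lemma ler_hnormB u v : hnorm (u - v) <= hnorm u + hnorm v.
Proof. by rewrite -(hnormN v) ler_hnormD. Qed.

Lemma hnormB u v : hnorm (u - v) = hnorm (v - u).
Proof. by rewrite -hnormN opprB. Qed.

Lemma hnormZ r u : hnorm (r%:C%C *: u) = `|r| * hnorm u.
Proof. by rewrite /hnorm normrZ normc_def /= expr0n addr0 sqrtr_sqr Re_mul /= mul0r subr0. Qed.

Lemma hnormi u : hnorm ('i%C *: u) = hnorm u.
Proof. by apply/eqP; rewrite -(@eqrXn2 _ 2) ?hnorm_ge0 // -!ipuu ipii. Qed.

Lemma ip_sqr_le u (M : R) : 0 <= M -> ip u u <= M ^+ 2 -> hnorm u <= M.
Proof. by move=> M0; rewrite ipuu ler_pXn2r // ?nnegrE ?hnorm_ge0. Qed.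

Lemma discr_le (a b c : R) : 0 <= c -> (forall t, 0 <= a + 2 * t * b + t ^+ 2 * c) ->
  b ^+ 2 <= a * c.
Proof.
move=> c0 h; have [c00|cn0] := eqVneq c 0.
  have [->|b0] := eqVneq b 0; first by rewrite c00 mulr0 expr0n.
  (* With c = 0 and b nonzero the polynomial is affine in t, and this t gives it the value -1. *)
  have := h (- (a + 1) / (2 * b)); rewrite c00 mulr0 addr0.
  rewrite (_ : a + _ = -1); last by field.
  by rewrite ler0N1.
have cp : 0 < c by rewrite lt_neqAle eq_sym cn0.
(* The minimizer of the quadratic. *)
have := h (- b / c).
rewrite (_ : a + _ + _ = (a * c - b ^+ 2) / c); last by field.
by rewrite pmulr_lge0 ?invr_gt0 // subr_ge0.
Qed.

Lemma ip_CS u v : ip u v ^+ 2 <= ip u u * ip v v.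
Proof.
apply: discr_le; first exact: ip_ge0.
move=> t; have := ip_ge0 (u + t%:C%C *: v).
rewrite !(ipDl, ipDr, ipZl, ipZr) (ipC v u) => h.
by apply: le_trans h _; rewrite le_eqVlt; apply/orP; left; apply/eqP; ring.
Qed.

Lemma ip_le u v : ip u v <= hnorm u * hnorm v.
Proof.
have h := ip_CS u v; rewrite !ipuu -exprMn in h.
have h0 : 0 <= hnorm u * hnorm v by rewrite mulr_ge0 ?hnorm_ge0.
have [i0|i0] := leP 0 (ip u v); last by rewrite (le_trans (ltW i0)).
by rewrite ler_pXn2r // in h.
Qed.

Lemma ip_ext u v : (forall w, ip u w = ip v w) -> u = v.
Proof.
by move=> h; apply/eqP; rewrite -subr_eq0; apply/eqP/ip_eq0; rewrite ipDl ipNl h subrr.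
Qed.

Lemma parallelogram u v :
  ip (u + v) (u + v) + ip (u - v) (u - v) = 2 * ip u u + 2 * ip v v.
Proof. rewrite !(ipDl, ipDr, ipNl, ipNr); ring. Qed.

End InnerProduct.

(** * Norm convergence and density in a Hilbert space *)

Section Topology.
Variables (R : realType) (H : hilbert R).
Implicit Types (u v w : H).

Definition hcauchy (x : nat -> H) := forall e : R, 0 < e ->
  exists N : nat, forall m n, (N <= m)%N -> (N <= n)%N -> hnorm (x m - x n) < e.

Definition hlim (x : nat -> H) (l : H) := forall e : R, 0 < e ->
  exists N : nat, forall n, (N <= n)%N -> hnorm (x n - l) < e.

Lemma hcauchy_lim x : hcauchy x -> exists l, hlim x l.
Proof.
move=> cx.
have real_pos (e : R[i]) : 0 < e -> e = (complex.Re e)%:C%C by move=> e0; rewrite RRe_real // gtr0_real.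
have c : cauchy (x @ \oo).
  apply/cauchy_ballP => e e0 /=.
  have eE := real_pos _ e0.
  rewrite eE in e0 *.
  rewrite ltcR in e0.
  have [N hN] := cx _ e0.
  exists (x @` [set n | (N <= n)%N], x @` [set n | (N <= n)%N]) => /=.
    by split; exists N => // n /= Nn; exists n.
  case=> p q [] /= [m Nm <-] [n Nn <-].
  by rewrite -ball_normE /= normE ltcR; apply: hN.
have /cauchy_cvgP/cvg_ex[l hl] := c.
exists l => e e0.
have /cvgrPdist_lt/(_ e%:C%C) := hl.
rewrite ltcR => /(_ e0) [N _ hN]; exists N => n Nn.
by have := hN n Nn; rewrite /= normE ltcR hnormB.
Qed.

Definition hdense (S : set H) := forall u (e : R), 0 < e -> exists2 v, S v & hnorm (u - v) < e.

Lemma denseP (S : set H) : dense S <-> hdense S.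
Proof.
split.
  move=> dS u e e0.
  have [||v []] := dS (ball u e%:C%C).
  - by exists u; apply: ballxx; rewrite ltcR.
  - exact: ball_open.
  - rewrite -ball_normE /= normE ltcR => h1 h2; by exists v.
move=> hS O [u Ou] oO.
have /nbhs_ballP[e /= e0] : nbhs u O by exact: open_nbhs_nbhs.
have eE : e = (complex.Re e)%:C%C by rewrite RRe_real // gtr0_real.
rewrite eE ltcR in e0 *.
move=> sub; have [v Sv uv] := hS u _ e0.
by exists v; split=> //; apply: sub; rewrite -ball_normE /= normE ltcR.
Qed.
End Topology.

(** Replaces limit arguments when an inequality holds up to an arbitrarily small error. The test
    value x / (2 (|c| + 1)) keeps c e below x whatever the sign of c. *)
Lemma le0_of_small (R : realType) (x c : R) : (forall e, 0 < e -> x <= c * e) -> x <= 0.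
Proof.
move=> h; rewrite leNgt; apply/negP => x0.
have := h (x / (2 * (`|c| + 1))); rewrite divr_gt0 ?mulr_gt0 ?ltr_pwDr // => /(_ isT).
rewrite leNgt => /negP; apply.
rewrite mulrA ltr_pdivrMr ?mulr_gt0 ?ltr_pwDr //.
have := ler_norm c; have := normr_ge0 c; nra.
Qed.

Lemma exists_natSinv_lt (R : realType) (e : R) : 0 < e ->
  exists N : nat, forall n, (N <= n)%N -> n.+1%:R^-1 < e.
Proof.
move=> e0; have [N _ hN] := near_infty_natSinv_lt (PosNum e0).
by exists N => n Nn; exact: hN.
Qed.

(** * Bounded operators, projections and adjoints *)

Section BoundedOperators.
Variables (R : realType) (H : hilbert R).
Implicit Types (u v w : H) (A B : op H).

Lemma bopD A : bounded_op A -> forall u v, A (u + v) = A u + A v.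
Proof. by case=> lA _ u v; rewrite -[u]scale1r lA !scale1r. Qed.
Lemma bop0 A : bounded_op A -> A 0 = 0.
Proof. by move=> bA; apply: (@addrI _ (A 0)); rewrite -(bopD bA) // !addr0. Qed.
Lemma bopZ A : bounded_op A -> forall (a : R[i]) u, A (a *: u) = a *: A u.
Proof. by move=> bA a u; have [lA _] := bA; rewrite -[a *: u]addr0 lA (bop0 bA) addr0. Qed.
Lemma bopN A : bounded_op A -> forall u, A (- u) = - A u.
Proof. by move=> bA u; rewrite -scaleN1r (bopZ bA) scaleN1r. Qed.
Lemma bopB A : bounded_op A -> forall u v, A (u - v) = A u - A v.
Proof. by move=> bA u v; rewrite (bopD bA) (bopN bA). Qed.

Lemma opaddE A B u : (A + B) u = A u + B u. Proof. by []. Qed.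
Lemma opscaleE (a : R[i]) A u : (a *: A) u = a *: A u. Proof. by []. Qed.
Lemma opoppE A u : (- A) u = - A u. Proof. by []. Qed.

Lemma bop_bound A : bounded_op A ->
  exists M : R, 0 < M /\ forall u, hnorm (A u) <= M * hnorm u.
Proof.
case=> _ [M hM]; exists (`|M| + 1); split; first by rewrite ltr_pwDr.
move=> u; apply: le_trans (hM u) _; apply: ler_wpM2r; first exact: hnorm_ge0.
by rewrite ler_wpDr // ler_norm.
Qed.

Lemma bounded_id : bounded_op (id : op H).
Proof. by split=> //; exists 1 => u; rewrite mul1r. Qed.

Lemma bounded_comp A B : bounded_op A -> bounded_op B -> bounded_op (A \o B).
Proof.
move=> bA bB; split=> [a u v|].
  by rewrite /= (bopD bB) (bopZ bB) (bopD bA) (bopZ bA).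
have [M [M0 hM]] := bop_bound bA; have [K [_ hK]] := bop_bound bB.
exists (M * K) => u /=; apply: le_trans (hM _) _.
by rewrite -mulrA ler_pM2l.
Qed.

Lemma bounded_add A B : bounded_op A -> bounded_op B -> bounded_op (A + B).
Proof.
move=> bA bB; split=> [a u v|].
  rewrite !opaddE (bopD bA) (bopD bB) (bopZ bA) (bopZ bB) scalerDr.
  by rewrite addrACA.
have [M [_ hM]] := bop_bound bA; have [K [_ hK]] := bop_bound bB.
exists (M + K) => u; rewrite mulrDl; apply: le_trans (ler_hnormD _ _) _.
exact: lerD.
Qed.

Lemma hnormZc (a : R[i]) u : hnorm (a *: u) = complex.Re `|a| * hnorm u.
Proof. by rewrite /hnorm normrZ Re_mul (@ger0_Im _ `|a|) // mul0r subr0. Qed.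

Lemma bounded_scale (a : R[i]) A : bounded_op A -> bounded_op (a *: A).
Proof.
move=> bA; split=> [b u v|].
  by rewrite !opscaleE (bopD bA) (bopZ bA) scalerDr !scalerA mulrC.
have [M [_ hM]] := bop_bound bA.
exists (complex.Re `|a| * M) => u; rewrite hnormZc -mulrA ler_wpM2l //.
have := normr_ge0 a; rewrite lecE => /andP[] //.
Qed.

Lemma bounded_opp A : bounded_op A -> bounded_op (- A).
Proof.
move=> bA; have -> : - A = (-1 : R[i]) *: A by rewrite scaleN1r.
exact: bounded_scale.
Qed.

Lemma bounded_sub A B : bounded_op A -> bounded_op B -> bounded_op (A - B).
Proof. by move=> bA bB; apply/bounded_add => //; exact: bounded_opp. Qed.

(** The third clause is norm closedness, which makes nearest points exist. *)
Definition subspace (M : set H) :=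
  [/\ M 0, forall (a : R[i]) u v, M u -> M v -> M (a *: u + v)
    & forall u, (forall e : R, 0 < e -> exists2 v, M v & hnorm (u - v) < e) -> M u].

Lemma subspace_ker A : bounded_op A -> subspace [set u | A u = 0].
Proof.
move=> bA; split=> /= [|a u v hu hv|u hu]; first exact: (bop0 bA).
  by rewrite (bopD bA) (bopZ bA) hu hv scaler0 add0r.
have [M [M0 hM]] := bop_bound bA.
apply: hnorm_eq0; apply: le_anti; rewrite hnorm_ge0 andbT.
apply: (@le0_of_small _ _ M) => e e0.
have [v hv uv] := hu e e0.
have -> : A u = A (u - v) by rewrite (bopB bA) hv subr0.
by apply: le_trans (hM _) _; rewrite ler_pM2l // ltW.
Qed.

Lemma hdot0_ip u v : hdot H u v = 0 <-> ip u v = 0 /\ ip u ('i%C *: v) = 0.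
Proof. by rewrite hdotE; split=> [[-> ->]|[-> ->]]. Qed.

Theorem projection (M : set H) u : subspace M ->
  exists2 p, M p & forall m, M m -> hdot H (u - p) m = 0.
Proof.
case=> M0 Ml Mc.
pose D := inf [set ip (u - m) (u - m) | m in M].
have hi : has_inf [set ip (u - m) (u - m) | m in M].
  split; first by exists (ip (u - 0) (u - 0)), 0.
  by exists 0 => _ [m _ <-]; apply: ip_ge0.
have Dle m : M m -> D <= ip (u - m) (u - m).
  by move=> Mm; apply: ge_inf; [case: hi|exists m].
have h n : exists m, M m /\ ip (u - m) (u - m) < D + n.+1%:R^-1.
  have e0 : 0 < n.+1%:R^-1 :> R by rewrite invr_gt0.
  by have [_ [m Mm <-] hm] := inf_adherent e0 hi; exists m.
clearbody D.
have [m hm] := choice h.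
(* Moving from m n along x cannot bring the squared distance below D, so the discriminant bound
   makes an almost minimal residual almost orthogonal to x. *)
have near_min n x : M x -> ip (u - m n) x ^+ 2 <= n.+1%:R^-1 * ip x x.
  move=> Mx; apply: discr_le; first exact: ip_ge0.
  move=> t; have := Dle ((-t)%:C%C *: x + m n).
  have [Mmn hmn] := hm n => /(_ (Ml _ _ _ Mx Mmn)).
  have -> : u - ((-t)%:C%C *: x + m n) = (u - m n) + t%:C%C *: x.
    by rewrite rmorphN /= scaleNr opprD opprK addrA addrAC.
  move: hmn; move: (u - m n) => z hmn.
  rewrite !(ipDl, ipDr, ipZl, ipZr) (ipC x z).
  move: hmn; move: (ip z z) (ip z x) (ip x x) (n.+1%:R^-1) => a b c d; rewrite expr2; lra.
have [p hp] : exists p, hlim m p.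
  apply: hcauchy_lim => e e0.
  (* By the parallelogram law |m i - m j|^2 is at most twice the two squared residuals minus 4 D; an
     excess below e^2 / 4 in each makes this less than e^2. *)
  have [|N hN] := @exists_natSinv_lt R (e ^+ 2 / 4); first by rewrite divr_gt0 ?exprn_gt0.
  exists N => i j Ni Nj.
  rewrite -(@ltr_pXn2r _ 2) ?nnegrE ?hnorm_ge0 ?(ltW e0) // -ipuu.
  have [Mi hi1] := hm i; have [Mj hj1] := hm j.
  have := Dle ((2^-1)%:C%C *: m i + ((2^-1)%:C%C *: m j + 0)).
  move=> /(_ (Ml _ _ _ Mi (Ml _ _ _ Mj M0))).
  set x := m i in Mi hi1 *; set y := m j in Mj hj1 *.
  have -> : u - ((2^-1)%:C%C *: x + ((2^-1)%:C%C *: y + 0)) =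
     (2^-1)%:C%C *: ((u - x) + (u - y)).
    have e2 : (2^-1)%:C%C + (2^-1)%:C%C = 1 :> R[i].
      by rewrite -rmorphD /=; congr (_%:C%C); field.
    rewrite !scalerDr !scalerN addr0 addrACA -scalerDl e2 scale1r.
    by rewrite opprD.
  rewrite ipZl ipZr.
  have := parallelogram (u - x) (u - y).
  have -> : u - x - (u - y) = - (x - y) by rewrite !opprB addrC addrA subrK.
  rewrite ipNl ipNr opprK.
  have := hN i Ni; have := hN j Nj; move: hi1 hj1.
  move: (j.+1%:R^-1) (i.+1%:R^-1) (ip (u - x) (u - x)) (ip (u - y) (u - y)).
  move: (ip (x - y) (x - y)) (e ^+ 2) => a b c d f g; lra.
have Mp : M p.
  apply: Mc => e e0; have [N hN] := hp e e0.
  by exists (m N); [case: (hm N)|rewrite hnormB; apply: hN].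
exists p => // x Mx.
(* M is stable under multiplication by i, so vanishing real parts are enough. *)
suff ort y : M y -> ip (u - p) y = 0.
  apply/hdot0_ip; split; apply: ort => //.
  by rewrite -[_ *: _]addr0; apply: Ml.
move=> {x Mx} My; apply/eqP; rewrite -sqrf_eq0 eq_le sqr_ge0 andbT.
(* Split u - p at m n: each of the two products with y has square at most e |y|^2, and (a + b)^2 <=
   2 (a^2 + b^2). *)
apply: (@le0_of_small _ _ (4 * ip y y)) => e e0.
have [N1 hN1] := exists_natSinv_lt e0.
have [|N2 hN2] := hp (Num.sqrt e); first by rewrite sqrtr_gt0.
pose n := maxn N1 N2.
have h1 := hN1 n (leq_maxl _ _).
have h2 : ip (m n - p) (m n - p) < e.
  rewrite ipuu -[ltRHS]sqr_sqrtr ?ltW // ltr_pXn2r ?nnegrE ?hnorm_ge0 ?sqrtr_ge0 //.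
  exact: hN2 (leq_maxr _ _).
have h3 := near_min n y My.
have h4 := ip_CS (m n - p) y.
have -> : u - p = (u - m n) + (m n - p) by rewrite addrA subrK.
rewrite ipDl; have y0 := ip_ge0 y.
have h5 : n.+1%:R^-1 * ip y y <= e * ip y y by rewrite ler_wpM2r // ltW.
have h6 : ip (m n - p) (m n - p) * ip y y <= e * ip y y by rewrite ler_wpM2r // ltW.
rewrite -mulrA [ip y y * e]mulrC.
move: h3 h4 h5 h6.
move: (ip (u - m n) y) (ip (m n - p) y) (_^-1 * ip y y) (_ * ip y y) (e * ip y y).
move=> a b c d f; have : 0 <= (a - b) ^+ 2 by apply: sqr_ge0.
rewrite sqrrB sqrrD; move: (a ^+ 2) (b ^+ 2) (a * b) => q r s; lra.
Qed.

(** A bound on real parts is enough: applied to the rotations of a vector by -1, i and -i, it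
    controls the modulus and makes the kernel closed. The representing vector is then a multiple of
    a vector orthogonal to the kernel. *)
Theorem riesz (f : H -> R[i]) (M : R) :
  (forall a u v, f (a *: u + v) = a * f u + f v) ->
  (forall u, complex.Re (f u) <= M * hnorm u) ->
  exists w, forall u, f u = hdot H u w.
Proof.
move=> fl fM.
have f0 : f 0 = 0.
  by apply: (@addrI _ (1 * f 0)); rewrite -fl !scaler0 !addr0 mul1r.
have fZ a u : f (a *: u) = a * f u by rewrite -[a *: u]addr0 fl f0 addr0.
have fB u v : f (u - v) = f u - f v.
  by rewrite addrC -scaleN1r fl mulN1r addrC.
have sK : subspace [set u | f u = 0].
  split=> [//|a u v /= hu hv|u hu]; first by rewrite fl hu hv mulr0 addr0.
  have Re_le0 (a : R[i]) : complex.Re `|a| = 1 -> complex.Re (a * f u) <= 0.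
    move=> a1; apply: (@le0_of_small _ _ `|M|) => e e0.
    have [v hv uv] := hu e e0.
    have -> : a * f u = f (a *: (u - v)) by rewrite fZ fB hv subr0.
    apply: le_trans (fM _) _; rewrite hnormZc a1 mul1r.
    apply: le_trans (_ : `|M| * hnorm (u - v) <= _).
      by rewrite ler_wpM2r ?hnorm_ge0 ?ler_norm.
    by rewrite ler_wpM2l // ltW.
  have h1 : complex.Re (f u) <= 0 by rewrite -[f u]mul1r; apply: Re_le0; rewrite normr1.
  have h2 : - complex.Re (f u) <= 0.
    rewrite -Re_opp -mulN1r; apply: Re_le0; by rewrite normrN normr1.
  have n_i : complex.Re `|'i%C : R[i]| = 1.
    by rewrite normc_def /= expr0n expr1n add0r sqrtr1.
  have h3 : - complex.Im (f u) <= 0.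
    by have := Re_le0 _ n_i; rewrite Re_mul /= mul0r mul1r add0r.
  have h4 : complex.Im (f u) <= 0.
    have := Re_le0 (- 'i%C); rewrite normrN => /(_ n_i).
    by rewrite mulNr Re_opp Re_mul /= mul0r mul1r add0r opprK.
  apply: complex_ext => /=; apply: le_anti; rewrite ?h1 ?h4 /=; lra.
have [all0|/existsNP[u0 fu0]] := pselect (forall u, f u = 0).
  by exists 0 => u; rewrite hdot0r.
have [p /= fp ort] := projection u0 sK.
set z := u0 - p in ort.
have fz : f z <> 0 by rewrite fB fp subr0.
have zz : hdot H z z != 0.
  apply/eqP => zz0; apply: fz; suff -> : z = 0 by [].
  by apply: ip_eq0; rewrite /ip zz0.
exists (Num.conj (f z / hdot H z z) *: z) => u.
(* This vector lies in the kernel, hence is orthogonal to z. *)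
have := ort (f u *: z - f z *: u); rewrite /= fB !fZ mulrC subrr => /(_ erefl).
rewrite hdotC => /(congr1 Num.conj); rewrite conjCK conjC0 hdotBl !hdotZl.
move/eqP; rewrite subr_eq0 => /eqP h.
by rewrite hdotZr conjCK mulrAC -h mulfK.
Qed.

Definition adjoint A B := forall u v, hdot H (A u) v = hdot H u (B v).

Lemma hdot_ext u v : (forall w, hdot H w u = hdot H w v) -> u = v.
Proof. by move=> h; apply: ip_ext => w; rewrite ipC /ip h -/(ip _ _) ipC. Qed.

Lemma adjoint_bounded A B : bounded_op A -> adjoint A B -> bounded_op B.
Proof.
move=> bA hAB; split=> [a u v|].
  by apply: hdot_ext => w; rewrite -hAB !(hdotDr, hdotZr) !hAB.
have [M [M0 hM]] := bop_bound bA; exists M => v.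
have := ip_le (A (B v)) v; rewrite {1}/ip hAB -/(ip _ _) ipuu.
have [->|n0] := eqVneq (hnorm (B v)) 0; first by rewrite mulr_ge0 ?hnorm_ge0 // ltW.
have h : 0 < hnorm (B v) by rewrite lt_neqAle eq_sym n0 hnorm_ge0.
move=> h1; have := le_trans h1 (ler_wpM2r (hnorm_ge0 v) (hM (B v))).
by rewrite mulrAC expr2 ler_pM2r.
Qed.

(** [adj] is a chosen value and needs a witness before it can be used; Riesz represents u |-> <A u,
    v> for each v. *)
Lemma adj_exists A : bounded_op A -> exists B, bounded_op B /\ adjoint A B.
Proof.
move=> bA; have [M [M0 hM]] := bop_bound bA.
have h v : exists w, forall u, hdot H (A u) v = hdot H u w.
  apply: (@riesz (fun u => hdot H (A u) v) (M * hnorm v)) => [a u w|u].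
    by rewrite (bopD bA) (bopZ bA) hdotDl hdotZl.
  apply: le_trans (ip_le _ _) _; rewrite mulrAC ler_wpM2r ?hnorm_ge0 //.
have [B hB] := choice h; exists B; split; last by move=> u v; apply: hB.
by apply: (adjoint_bounded bA) => u v; apply: hB.
Qed.

Lemma adjP A : bounded_op A -> bounded_op (adj A) /\ adjoint A (adj A).
Proof. by move=> bA; exact: (getPex (adj_exists bA)). Qed.

Lemma adjE A B : bounded_op A -> adjoint A B -> adj A = B.
Proof.
move=> bA hB; have [_ h] := adjP bA.
by apply: funext => v; apply: hdot_ext => w; rewrite -h -hB.
Qed.

Lemma adjoint_sym A B : adjoint A B -> adjoint B A.
Proof. by move=> h u v; rewrite hdotC -h -hdotC. Qed.

Lemma adjoint_comp A B A' B' : adjoint A A' -> adjoint B B' -> adjoint (A \o B) (B' \o A').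
Proof. by move=> hA hB u v /=; rewrite hA hB. Qed.

Lemma adjoint_add A B A' B' : adjoint A A' -> adjoint B B' -> adjoint (A + B) (A' + B').
Proof. by move=> hA hB u v; rewrite !opaddE hdotDl hdotDr hA hB. Qed.

Lemma adjoint_scale (a : R[i]) A A' : adjoint A A' -> adjoint (a *: A) (Num.conj a *: A').
Proof. by move=> hA u v; rewrite !opscaleE hdotZl hdotZr conjCK hA. Qed.

End BoundedOperators.

Section Limits.
Variables (R : realType) (H : hilbert R).
Implicit Types (u v w : H) (x y : nat -> H).

Lemma hlim_unique x u v : hlim x u -> hlim x v -> u = v.
Proof.
move=> hu hv; apply/eqP; rewrite -subr_eq0; apply/eqP/hnorm_eq0/le_anti.
rewrite hnorm_ge0 andbT; apply: (@le0_of_small _ _ 2) => e e0.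
have [N hN] := hu e e0; have [K hK] := hv e e0.
have := hN _ (leq_maxl N K); have := hK _ (leq_maxr N K).
set z := x _; have -> : u - v = (z - v) - (z - u) by rewrite opprB [RHS]addrC addrA subrK.
have := ler_hnormB (z - v) (z - u); lra.
Qed.

Lemma hlim_add x y u v : hlim x u -> hlim y v -> hlim (fun n => x n + y n) (u + v).
Proof.
move=> hu hv e e0; have e20 : 0 < e / 2 by rewrite divr_gt0.
have [N hN] := hu _ e20; have [K hK] := hv _ e20.
exists (maxn N K) => n; rewrite geq_max => /andP[Nn Kn].
have -> : x n + y n - (u + v) = (x n - u) + (y n - v) by rewrite opprD addrACA.
have := ler_hnormD (x n - u) (y n - v); have := hN n Nn; have := hK n Kn.
move: (hnorm (x n - u)) (hnorm (y n - v)) => a b; lra.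
Qed.

Lemma hlim_op (A : op H) x u : bounded_op A -> hlim x u -> hlim (fun n => A (x n)) (A u).
Proof.
move=> bA hu e e0; have [M [M0 hM]] := bop_bound bA.
have [|N hN] := hu (e / M); first by rewrite divr_gt0.
exists N => n Nn; rewrite -(bopB bA); apply: le_lt_trans (hM _) _.
by rewrite mulrC -ltr_pdivlMr // hN.
Qed.

Lemma hlim_scale (a : R[i]) x u : hlim x u -> hlim (fun n => a *: x n) (a *: u).
Proof. exact: (hlim_op (bounded_scale a (@bounded_id R H))). Qed.

Lemma hlim_cst u : hlim (fun _ => u) u.
Proof. by move=> e e0; exists 0%N => n _; rewrite subrr hnorm0. Qed.

Lemma hlim_shift x u : hlim x u -> hlim (fun n => x n.+1) u.
Proof.
by move=> h e e0; have [N hN] := h e e0; exists N => n Nn; apply: hN; apply: leqW.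
Qed.

Lemma hlim_hnorm_le x u (c : R) : (forall n, hnorm (x n) <= c) -> hlim x u -> hnorm u <= c.
Proof.
move=> hc hu; rewrite -subr_le0; apply: (@le0_of_small _ _ 1) => e e0.
have [N hN] := hu e e0; have := hN N (leqnn _); have := hc N.
rewrite -{2}(subKr (x N) u).
have := ler_hnormB (x N) (x N - u).
lra.
Qed.

Lemma hlim_ip x u v : hlim x u -> forall e : R, 0 < e -> exists N : nat, forall n, (N <= n)%N ->
  `|ip (x n) v - ip u v| < e.
Proof.
move=> hu e e0; have c0 : 0 < hnorm v + 1 by rewrite ltr_wpDl ?hnorm_ge0.
have [|N hN] := hu (e / (hnorm v + 1)); first by rewrite divr_gt0.
exists N => n Nn; have := hN n Nn; rewrite ltr_pdivlMr // => h.
have le z : ip z v <= hnorm z * (hnorm v + 1).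
  by apply: le_trans (ip_le _ _) _; rewrite ler_wpM2l ?hnorm_ge0 // lerDl.
rewrite -ipNl -ipDl ltr_norml; have := le (x n - u); have := le (- (x n - u)).
rewrite hnormN ipNl; move: h; lra.
Qed.

End Limits.

(** * Positive operators and square roots *)

Section Positive.
Variables (R : realType) (H : hilbert R).
Implicit Types (u v w : H) (A B X D : op H).

Definition selfadj A := adjoint A A.
Definition pos A := forall u, 0 <= ip (A u) u.

Lemma selfadj_ip A u v : selfadj A -> ip (A u) v = ip u (A v).
Proof. by move=> sA; rewrite /ip sA. Qed.

Lemma ip_selfadj A : bounded_op A -> (forall u v, ip (A u) v = ip u (A v)) -> selfadj A.
Proof. by move=> bA h u v; rewrite !hdotE -(bopZ bA) -!h. Qed.

(** Over the complex numbers a real quadratic form forces self-adjointness: reality at u + v and at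
    u + i v gives the two parts of <A u, v> = <u, A v>. *)
Lemma psdP A : bounded_op A -> psd A <-> selfadj A /\ pos A.
Proof.
move=> bA; split=> [pA|[sA pA] u]; last first.
  have := sA u u; rewrite complex_ge0 -/(ip _ _) pA andbT.
  rewrite [RHS]hdotC => /(congr1 (@complex.Im R)); rewrite Im_conj => h.
  by apply/eqP; move: h; lra.
have im0 u : complex.Im (hdot H (A u) u) = 0.
  by have := pA u; rewrite complex_ge0 => /andP[/eqP].
split; last by move=> u; have := pA u; rewrite complex_ge0 => /andP[].
move=> u v; rewrite [RHS]hdotC; apply: complex_ext; rewrite ?Re_conj ?Im_conj.
  have := im0 (u + 'i%C *: v); rewrite (bopD bA) (bopZ bA).
  rewrite !(hdotDl, hdotDr) !Im_add !im0 add0r.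
  rewrite !(hdotZl, hdotZr) !(Im_mul, Re_mul) !(Re_conj, Im_conj) im0 /=; lra.
have := im0 (u + v); rewrite (bopD bA).
by rewrite !(hdotDl, hdotDr) !Im_add !im0 /=; lra.
Qed.

Lemma pos_CS A u v : bounded_op A -> selfadj A -> pos A ->
  ip (A u) v ^+ 2 <= ip (A u) u * ip (A v) v.
Proof.
move=> bA sA pA; apply: discr_le => // t.
have := pA (u + t%:C%C *: v); rewrite (bopD bA) (bopZ bA).
rewrite !(ipDl, ipDr, ipZl, ipZr) (selfadj_ip v u sA) (ipC v).
move: (ip (A u) u) (ip (A u) v) (ip (A v) v) => a b c; rewrite expr2; lra.
Qed.

Lemma quad_ext A B : bounded_op A -> bounded_op B -> selfadj A -> selfadj B ->
  (forall u, ip (A u) u = ip (B u) u) -> A = B.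
Proof.
move=> bA bB sA sB h; apply: funext => u; apply: ip_ext => v.
have := h (u + v); rewrite (bopD bA) (bopD bB) !(ipDl, ipDr) !h.
rewrite (selfadj_ip v u sA) (selfadj_ip v u sB) (ipC v (A u)) (ipC v (B u)); lra.
Qed.

Lemma selfadj_add A B : selfadj A -> selfadj B -> selfadj (A + B).
Proof. exact: adjoint_add. Qed.

Lemma selfadj_scale (r : R) A : selfadj A -> selfadj (r%:C%C *: A).
Proof.
move=> sA; have := adjoint_scale r%:C%C sA.
by congr (adjoint _ (_ *: _)); apply: complex_ext; rewrite ?Re_conj ?Im_conj //= oppr0.
Qed.

Lemma selfadj_opp A : selfadj A -> selfadj (- A).
Proof. by move=> sA u v; rewrite !opoppE hdotNl hdotNr sA. Qed.

Lemma selfadj_sub A B : selfadj A -> selfadj B -> selfadj (A - B).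
Proof. by move=> sA sB; apply: selfadj_add => //; apply: selfadj_opp. Qed.

Lemma selfadj_id : selfadj id. Proof. by []. Qed.

(** Cauchy-Schwarz for the form of A at u and A u gives |A u|^4 <= <A u, u> K |A u|^2; divide by |A
    u|^2. *)
Lemma pos_form_le A (K : R) u : bounded_op A -> selfadj A -> pos A ->
  (forall v, ip (A v) v <= K * ip v v) ->
  ip (A u) (A u) <= K * ip (A u) u.
Proof.
move=> bA sA pA hK; have := pos_CS u (A u) bA sA pA.
have := pA u; have := hK (A u); have := ip_ge0 (A u).
have K0 : ip (A u) (A u) != 0 -> 0 < ip (A u) (A u).
  by rewrite lt_neqAle eq_sym ip_ge0 andbT.
case: (eqVneq (ip (A u) (A u)) 0) K0 => [z _ _ _ _ _|_ /(_ isT)].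
  have /ip_eq0 -> := z; rewrite !ip0l mulr0 //.
move: (ip (A u) (A u)) (ip (A u) u) (ip (A (A u)) _) => a b c a0 _ hc b0 h.
rewrite -(ler_pM2l a0); apply: le_trans (_ : b * c <= _); first by rewrite -expr2.
by rewrite mulrCA [a * b]mulrC mulrCA; apply: ler_wpM2l.
Qed.

Lemma bop_form_bound A : bounded_op A ->
  exists M : R, 0 < M /\ forall u, ip (A u) u <= M * ip u u.
Proof.
move=> bA; have [M [M0 hM]] := bop_bound bA; exists M; split=> // u.
apply: le_trans (ip_le _ _) _; rewrite ipuu expr2 mulrA.
by rewrite ler_wpM2r ?hnorm_ge0.
Qed.

End Positive.

Lemma subr_split (V : zmodType) (x y z : V) : x - y = (x - z) + (z - y).
Proof. by rewrite addrA subrK. Qed.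

Section SquareRoot.
Variables (R : realType) (H : hilbert R).
Implicit Types (u v w : H) (A B X D : op H).

Definition contraction A := forall u, hnorm (A u) <= hnorm u.

Section Iteration.
Variable S : op H.
Hypotheses (bS : bounded_op S) (sS : selfadj S) (cS : contraction S).

(* The iteration y <- (S + y^2) / 2 converges to the solution of (1 - y)^2 = 1 - S; the
   scalar iteration for S = 1 bounds its steps. *)
Fixpoint sqrt_iter n : op H :=
  if n is m.+1 then (2^-1)%:C%C *: (S + (sqrt_iter m \o sqrt_iter m)) else 0.

Fixpoint scalar_iter n : R := if n is m.+1 then 2^-1 * (1 + scalar_iter m ^+ 2) else 0.

Lemma scalar_iter_bound n : 0 <= scalar_iter n <= 1.
Proof.
elim: n => [|n /andP[h0 h1]] /=; first by rewrite lexx ler01.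
by move: h0 h1; set q := scalar_iter n; move=> h0 h1; apply/andP; split; nra.
Qed.

Lemma scalar_iter_incr n : 0 <= scalar_iter n.+1 - scalar_iter n.
Proof.
have -> : scalar_iter n.+1 - scalar_iter n = 2^-1 * (1 - scalar_iter n) ^+ 2.
  by rewrite /=; field.
by rewrite mulr_ge0 ?sqr_ge0.
Qed.

Lemma bounded_zero : bounded_op (0 : op H).
Proof.
split=> [a u v|]; first by rewrite /GRing.zero /= scaler0 addr0.
by exists 0 => u; rewrite mul0r /GRing.zero /= hnorm0.
Qed.

Lemma sqrt_iter_bounded n : bounded_op (sqrt_iter n).
Proof.
elim: n => [|n IH] /=; first exact: bounded_zero.
by apply/bounded_scale/bounded_add => //; apply: bounded_comp.
Qed.

Lemma sqrt_iter_selfadj n : selfadj (sqrt_iter n).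
Proof.
elim: n => [|n IH] /=; first by move=> u v; rewrite /GRing.zero /= hdot0l hdot0r.
apply: selfadj_scale; apply: selfadj_add => //; exact: (adjoint_comp IH IH).
Qed.

(** The iterates are polynomials in S. This commutation survives in the square root and finally lets
    |X| commute with X. *)
Lemma sqrt_iter_commute B n : bounded_op B -> B \o S = S \o B ->
  B \o sqrt_iter n = sqrt_iter n \o B.
Proof.
move=> bB BS; apply: funext; elim: n => [|n IH] u /=.
  by rewrite /GRing.zero /= (bop0 bB).
rewrite !opscaleE !opaddE (bopZ bB) (bopD bB) /=; congr (_ *: (_ + _)).
  by have := congr1 (fun f => f u) BS.
by have /= -> := IH (sqrt_iter n u); have /= -> := IH u.
Qed.

Lemma hnormZ_half u : hnorm ((2^-1)%:C%C *: u) = 2^-1 * hnorm u.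
Proof. by rewrite hnormZ ger0_norm. Qed.

Lemma sqrt_iter_norm n u : hnorm (sqrt_iter n u) <= scalar_iter n * hnorm u.
Proof.
elim: n u => [|n IH] u /=; first by rewrite /GRing.zero /= hnorm0 mul0r.
rewrite opscaleE hnormZ_half -mulrA ler_pM2l // mulrDl mul1r.
apply: le_trans (ler_hnormD _ _) _; apply: lerD; first exact: cS.
apply: le_trans (IH _) _; rewrite expr2 -mulrA.
by apply: ler_wpM2l (IH u); have /andP[] := scalar_iter_bound n.
Qed.

(** Telescoping y'^2 - y^2 = y' (y' - y) + (y' - y) y matches the factorization of the scalar
    difference term by term, so operator steps are dominated by scalar steps. *)
Lemma sqrt_iter_step n u : hnorm (sqrt_iter n.+1 u - sqrt_iter n u) <=
  (scalar_iter n.+1 - scalar_iter n) * hnorm u.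
Proof.
elim: n u => [|n IH] u.
  have -> : sqrt_iter 1 u - sqrt_iter 0 u = (2^-1)%:C%C *: (S u + 0) - 0 by [].
  rewrite /= !subr0 addr0 expr0n addr0 mulr1 hnormZ_half.
  by rewrite ler_pM2l // cS.
have -> : sqrt_iter n.+2 u - sqrt_iter n.+1 u = (2^-1)%:C%C *:
    (sqrt_iter n.+1 (sqrt_iter n.+1 u - sqrt_iter n u) +
     (sqrt_iter n.+1 (sqrt_iter n u) - sqrt_iter n (sqrt_iter n u))).
  rewrite (bopB (sqrt_iter_bounded _)) addrA subrK.
  rewrite [in LHS]/= !opscaleE !opaddE -scalerBr; congr (_ *: _).
  by rewrite opprD addrACA subrr add0r.
have -> : scalar_iter n.+2 - scalar_iter n.+1 =
    2^-1 * (scalar_iter n.+1 + scalar_iter n) * (scalar_iter n.+1 - scalar_iter n).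
  have e1 : scalar_iter n.+1 = 2^-1 * (1 + scalar_iter n ^+ 2) by [].
  have e2 : scalar_iter n.+2 = 2^-1 * (1 + scalar_iter n.+1 ^+ 2) by [].
  rewrite e2 -mulrA [X in _ = _ * X]mulrC -subr_sqr [X in _ - X = _]e1; ring.
rewrite hnormZ_half -!mulrA ler_pM2l // mulrDl; apply: le_trans (ler_hnormD _ _) _.
have /andP[a0 _] := scalar_iter_bound n.+1; apply: lerD.
  by apply: le_trans (sqrt_iter_norm _ _) _; apply: ler_wpM2l (IH u).
apply: le_trans (IH _) _; rewrite [leRHS]mulrCA; apply: ler_wpM2l.
  exact: scalar_iter_incr.
exact: sqrt_iter_norm.
Qed.

Lemma sqrt_iter_dist m n u : (n <= m)%N -> hnorm (sqrt_iter m u - sqrt_iter n u) <=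
  (scalar_iter m - scalar_iter n) * hnorm u.
Proof.
move/subnK <-; elim: (m - n)%N => [|k IH]; first by rewrite !subrr hnorm0 mul0r.
rewrite addSn (subr_split _ _ (sqrt_iter (k + n) u)) (subr_split _ _ (scalar_iter (k + n))) mulrDl.
by apply: le_trans (ler_hnormD _ _) _; apply: lerD => //; apply: sqrt_iter_step.
Qed.

Lemma scalar_iter_cauchy (e : R) : 0 < e -> exists N : nat, forall m n,
  (N <= n)%N -> scalar_iter m - scalar_iter n < e.
Proof.
move=> e0; have hs : has_sup (range scalar_iter).
  split; first by exists (scalar_iter 0), 0%N.
  by exists 1 => _ [n _ <-]; have /andP[] := scalar_iter_bound n.
have [_ [N _ <-] hN] := sup_adherent e0 hs.
exists N => m n Nn.
have le_m : scalar_iter m <= sup (range scalar_iter) by apply: ub_le_sup; [case: hs|exists m].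
have : scalar_iter N <= scalar_iter n.
  by apply: (homo_leq (@lexx _ _) (@le_trans _ _)) Nn => k; rewrite -subr_ge0 scalar_iter_incr.
by move: hN le_m; move: (sup _) => s; lra.
Qed.

Lemma sqrt_iter_lim u : exists v, hlim (fun n => sqrt_iter n u) v.
Proof.
apply: hcauchy_lim => e e0; have c0 : 0 < hnorm u + 1 by rewrite ltr_wpDl ?hnorm_ge0.
have [|N hN] := @scalar_iter_cauchy (e / (hnorm u + 1)); first by rewrite divr_gt0.
have main m n : (N <= n)%N -> (n <= m)%N -> hnorm (sqrt_iter m u - sqrt_iter n u) < e.
  move=> Nn nm; apply: le_lt_trans (sqrt_iter_dist _ nm) _.
  have := hN m n Nn; rewrite ltr_pdivlMr //; apply: le_lt_trans.
  apply: ler_wpM2l; last by rewrite lerDl.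
  rewrite subr_ge0; apply: (homo_leq (@lexx _ _) (@le_trans _ _)) nm => k.
  by rewrite -subr_ge0 scalar_iter_incr.
exists N => m n Nm Nn; have [nm|mn] := leqP n m; first exact: main.
by rewrite hnormB; apply: main => //; apply: ltnW.
Qed.

Lemma sqrt_contraction_exists : exists y : op H,
  [/\ bounded_op y, selfadj y, contraction y,
      (forall u, y u = (2^-1)%:C%C *: (S u + y (y u))) &
      forall B, bounded_op B -> B \o S = S \o B -> B \o y = y \o B].
Proof.
have [y hy] := choice sqrt_iter_lim.
have cI n : contraction (sqrt_iter n).
  move=> u; apply: le_trans (sqrt_iter_norm _ _) _; rewrite ler_piMl ?hnorm_ge0 //.
  by have /andP[] := scalar_iter_bound n.
have cy : contraction y by move=> u; apply: (hlim_hnorm_le _ (hy u)) => n; apply: cI.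
have bI := sqrt_iter_bounded.
have bY : bounded_op y.
  split=> [a u v|]; last by exists 1 => u; rewrite mul1r; apply: cy.
  apply: hlim_unique (hy _) _.
  have := hlim_add (hlim_scale a (hy u)) (hy v).
  by congr (hlim _ _); apply: funext => n; rewrite (bopD (bI n)) (bopZ (bI n)).
exists y; split=> //.
- apply: ip_selfadj => // u v; apply/eqP; rewrite -subr_eq0 -normr_le0.
  apply: (@le0_of_small _ _ 2) => e e0.
  have [N hN] := hlim_ip v (hy u) e0; have [K hK] := hlim_ip u (hy v) e0.
  have := hN _ (leq_maxl N K); have := hK _ (leq_maxr N K).
  set n := maxn N K; rewrite (ipC _ u) (ipC _ u).
  rewrite (selfadj_ip u v (sqrt_iter_selfadj n)).
  move: (ip u (sqrt_iter n v)) (ip u (y v)) (ip (y u) v) => a b c.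
  by rewrite !ltr_norml => /andP[h1 h2] /andP[h3 h4]; rewrite ler_norml; apply/andP; split; lra.
- move=> u; apply: hlim_unique (hlim_shift (hy u)) _.
  apply: hlim_scale; apply: hlim_add (hlim_cst _) _ => e e0.
  have e20 : 0 < e / 2 by rewrite divr_gt0.
  have [N hN] := hy u _ e20; have [K hK] := hy (y u) _ e20.
  exists (maxn N K) => n; rewrite geq_max => /andP[Nn Kn].
  rewrite -[X in hnorm (X - _)]/(sqrt_iter n (sqrt_iter n u)).
  (* Convergence is only pointwise: the first difference is controlled because the iterates are
     contractions, the second by convergence at the vector y u. *)
  rewrite (subr_split _ _ (sqrt_iter n (y u))) -(bopB (bI n)).
  have := ler_hnormD (sqrt_iter n (sqrt_iter n u - y u)) (sqrt_iter n (y u) - y (y u)).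
  have := hN n Nn; have := hK n Kn; have := cI n (sqrt_iter n u - y u).
  move: (hnorm _) (hnorm _) (hnorm _) (hnorm _) => a b c d; lra.
- move=> B bB BS; apply: funext => u /=; apply: hlim_unique (hlim_op bB (hy u)) _.
  have := hy (B u); congr (hlim _ _); apply: funext => n.
  by have := congr1 (fun f => f u) (sqrt_iter_commute n bB BS).
Qed.

End Iteration.

(** Scaling by a form bound M puts S = 1 - A / M between 0 and 1. The limit y satisfies 2 y = S +
    y^2, that is (1 - y)^2 = A / M, so the root is sqrt M (1 - y). *)
Theorem sqrt_exists A : bounded_op A -> selfadj A -> pos A -> exists C : op H,
  [/\ bounded_op C, selfadj C, pos C, C \o C = A &
      forall B, bounded_op B -> B \o A = A \o B -> B \o C = C \o B].
Proof.
move=> bA sA pA; have [M [M0 hM]] := bop_form_bound bA.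
pose S : op H := id - (M^-1)%:C%C *: A.
have bI := @bounded_id R H.
have bS : bounded_op S by apply: bounded_sub => //; apply: bounded_scale.
have sS : selfadj S by apply: selfadj_sub => //; apply: selfadj_scale.
have ipS u : ip (S u) u = ip u u - M^-1 * ip (A u) u by rewrite ipDl ipNl ipZl.
have pS : pos S.
  by move=> u; rewrite ipS subr_ge0 mulrC ler_pdivrMr // mulrC.
have leS u : ip (S u) u <= 1 * ip u u.
  by rewrite ipS mul1r lerBlDr lerDl mulr_ge0 // invr_ge0 ltW.
have cS : contraction S.
  move=> u; apply: ip_sqr_le; first exact: hnorm_ge0.
  rewrite -ipuu -[leRHS]mul1r; apply: le_trans (pos_form_le u bS sS pS leS) _.
  by rewrite mul1r.
have [y [bY sY cY eY comY]] := sqrt_contraction_exists bS sS cS.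
pose r := (Num.sqrt M)%:C%C.
pose C : op H := r *: (id - y).
have bC : bounded_op C by apply: bounded_scale; apply: bounded_sub.
exists C; split=> //.
- by apply: selfadj_scale; apply: selfadj_sub.
- move=> u; rewrite ipZl ipDl ipNl mulr_ge0 ?sqrtr_ge0 // subr_ge0.
  apply: le_trans (ip_le _ _) _; rewrite ipuu expr2.
  by rewrite ler_wpM2r ?hnorm_ge0.
- apply: funext => u /=; rewrite /C !opscaleE !opaddE !opoppE.
  have b1 : bounded_op ((id : op H) - y) by apply: bounded_sub.
  rewrite -[X in r *: X](opaddE id (- y)) (bopZ b1) scalerA.
  rewrite !opaddE !opoppE (bopB bY).
  have -> : r * r = M%:C%C by rewrite -rmorphM -expr2 sqr_sqrtr // ltW.
  have h : y (y u) = y u + y u - S u.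
    have := eY u => /(congr1 (fun x => 2%:C%C *: x)).
    rewrite scalerA -rmorphM divff //= scale1r.
    rewrite (_ : 2%:C%C = 1 + 1) ?scalerDl ?scale1r; last by rewrite -rmorphD.
    by move->; rewrite addrC addKr.
  rewrite h /S opaddE opoppE opscaleE.
  have -> : u - y u - (y u - (y u + y u - (u - (M^-1)%:C%C *: A u))) = (M^-1)%:C%C *: A u.
    move: (u - _ *: _) (subKr u ((M^-1)%:C%C *: A u)) => w <-.
    have -> : y u - (y u + y u - w) = w - y u by rewrite opprB addrCA opprD (addrA (y u)) subrr add0r.
    by rewrite opprB -subr_split.
  by rewrite scalerA -rmorphM divff ?scale1r // gt_eqF.
- move=> B bB BA.
  have BS : B \o S = S \o B.
    apply: funext => u; have := congr1 (fun f => f u) BA => /= e.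
    by rewrite /S !(opaddE, opoppE, opscaleE) (bopB bB) (bopZ bB) e.
  apply: funext => u; have := congr1 (fun f => f u) (comY B bB BS) => /= e.
  by rewrite /C !(opaddE, opoppE, opscaleE) (bopZ bB) (bopB bB) e.
Qed.

(* Take an approximate eigenvector [u] of [X - B] for [mu > 0], the supremum of its form: then
   |X u| is close to |B u + mu u|, which is larger than |B u|. *)
Lemma form_le_of_norm_eq X B : bounded_op X -> selfadj X ->
  bounded_op B -> selfadj B -> pos B -> (forall u, ip (X u) (X u) = ip (B u) (B u)) ->
  forall u, ip (X u) u <= ip (B u) u.
Proof.
move=> bX sX bB sB pB XB; apply: contrapT => /existsNP[u0 /negP]; rewrite -ltNge => hu0.
pose Y := X - B; have bY : bounded_op Y by apply: bounded_sub.
have sY : selfadj Y by apply: selfadj_sub.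
have ipY u : ip (Y u) u = ip (X u) u - ip (B u) u by rewrite ipDl ipNl.
have [K0 [K00 hK0]] := bop_form_bound bY.
pose E := [set ip (Y u) u | u in [set u | ip u u = 1]].
(* Normalizing vectors turns the supremum over the unit sphere into a form bound; [u0] is nonzero
   and shows that the sphere is not empty. *)
have Y_homog u : ip (Y u) u <= sup E * ip u u /\ has_sup E.
  have hub : has_ubound E by exists K0 => _ [v /= v1 <-]; have := hK0 v; rewrite v1 mulr1.
  have normalize v : v != 0 -> E (ip (Y v) v / ip v v).
    move=> v0; have n0 : hnorm v != 0 by apply: contra_neq v0; apply: hnorm_eq0.
    exists ((hnorm v)^-1%:C%C *: v) => /=.
      by rewrite ipZl ipZr ipuu; field.
    by rewrite (bopZ bY) ipZl ipZr ipuu; field.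
  have u00 : u0 != 0.
    by apply: contraTneq hu0 => ->; rewrite !ip0r ltxx.
  split; last by split=> //; exists (ip (Y u0) u0 / ip u0 u0); apply: normalize.
  have [->|un0] := eqVneq u 0; first by rewrite !ip0r mulr0.
  have ip0 : 0 < ip u u.
    by rewrite lt_neqAle ip_ge0 andbT eq_sym; apply: contra_neq un0; apply: ip_eq0.
  by rewrite -ler_pdivrMr //; apply: ub_le_sup => //; apply: normalize.
have [_ hs] := Y_homog u0.
set mu := sup E in Y_homog.
have mu0 : 0 < mu.
  have := (Y_homog u0).1; rewrite ipY => h; rewrite ltNge; apply/negP => mu_le0.
  have := ip_ge0 u0; move: hu0 h; nra.
pose Z : op H := mu%:C%C *: (id : op H) - Y.
have bZ : bounded_op Z by apply: bounded_sub => //; apply: bounded_scale; apply: bounded_id.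
have sZ : selfadj Z by apply: selfadj_sub => //; apply: selfadj_scale; apply: selfadj_id.
have ipZ u : ip (Z u) u = mu * ip u u - ip (Y u) u by rewrite ipDl ipNl ipZl.
have pZ : pos Z by move=> u; rewrite ipZ subr_ge0; have [] := Y_homog u.
have [K [K1 hK]] := bop_form_bound bZ.
have [L [L0 hL]] := bop_bound bB.
suff : mu ^+ 2 <= 0 by rewrite leNgt exprn_gt0.
(* With a = |B u| <= L the final estimate gives a^2 + mu^2 <= (a + d)^2, the term 2 mu <B u, u>
   being nonnegative. Hence mu^2 <= 2 L d + d^2, and d <= 1, d <= e bound this by (2 L + 1) e. *)
apply: (@le0_of_small _ _ (2 * L + 1)) => e e0.
pose d := Num.min e 1.
have d0 : 0 < d by rewrite lt_min e0 ltr01.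
have d1 : d <= 1 by rewrite ge_min lexx orbT.
have de : d <= e by rewrite ge_min lexx.
(* An error d^2 / K in the supremum means <Z u, u> <= d^2 / K, hence |Z u| <= d. *)
have dK : 0 < d ^+ 2 / K by rewrite divr_gt0 ?exprn_gt0.
have [_ [u /= u1 <-] hu] := sup_adherent dK hs.
have Zu : hnorm (Z u) <= d.
  apply: ip_sqr_le; first exact: ltW.
  apply: le_trans (pos_form_le u bZ sZ pZ hK) _.
  by rewrite mulrC -ler_pdivlMr // ipZ u1 mulr1 lerBlDr addrC -lerBlDr ltW.
have eX : X u = B u + mu%:C%C *: u - Z u.
  by rewrite /Z /Y !(opaddE, opoppE, opscaleE) opprB -[X in _ + X]addrA -opprD [RHS]addrC subrK.
have hn1 : hnorm u = 1.
  by apply/eqP; rewrite -(@eqrXn2 _ 2) ?hnorm_ge0 // -ipuu u1 expr1n.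
have hBu : hnorm (B u) <= L by have := hL u; rewrite hn1 mulr1.
have h1 : hnorm (B u + mu%:C%C *: u) <= hnorm (B u) + d.
  have -> : B u + mu%:C%C *: u = X u + Z u by rewrite eX subrK.
  apply: le_trans (ler_hnormD _ _) _; rewrite lerD //.
  by apply: ip_sqr_le; rewrite ?hnorm_ge0 // -ipuu XB.
have h2 : hnorm (B u + mu%:C%C *: u) ^+ 2 <= (hnorm (B u) + d) ^+ 2.
  by rewrite ler_pXn2r // nnegrE ?hnorm_ge0 // addr_ge0 ?hnorm_ge0 // ltW.
move: h2; rewrite -ipuu !(ipDl, ipDr, ipZl, ipZr) (ipC u) u1 (ipuu (B u)).
have := pB u; have := hnorm_ge0 (B u); move: hBu.
move: (hnorm (B u)) (ip (B u) u) => a b; nra.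
Qed.

(** Equal squares give |B v| = |C v| for all v, so the comparison of forms applies in both
    directions. *)
Lemma sqrt_unique B C : bounded_op B -> selfadj B -> pos B ->
  bounded_op C -> selfadj C -> pos C -> B \o B = C \o C -> B = C.
Proof.
move=> bB sB pB bC sC pC BC; apply: quad_ext => // u.
have h v : ip (B v) (B v) = ip (C v) (C v).
  rewrite (selfadj_ip _ _ sB) (selfadj_ip _ _ sC).
  by have /= -> := congr1 (fun f => f v) BC.
apply: le_anti; apply/andP; split; first exact: form_le_of_norm_eq.
by apply: form_le_of_norm_eq => // v; rewrite h.
Qed.

Lemma opsqrtP A : bounded_op A -> psd A ->
  [/\ bounded_op (opsqrt A), psd (opsqrt A) & opsqrt A \o opsqrt A = A].
Proof.
move=> bA /(psdP bA)[sA pA]; have [C [bC sC pC CC _]] := sqrt_exists bA sA pA.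
apply: (@getPex _ [set B : op H | [/\ bounded_op B, psd B & B \o B = A]]).
by exists C; split=> //; apply/psdP.
Qed.

Lemma opsqrtE B : bounded_op B -> psd B -> opsqrt (B \o B) = B.
Proof.
move=> bB pB; have /(psdP bB)[sB qB] := pB.
have bBB : bounded_op (B \o B) by apply: bounded_comp.
have pBB : psd (B \o B).
  apply/psdP => //; split; first exact: (adjoint_comp sB sB).
  by move=> u /=; rewrite (selfadj_ip _ _ sB) ip_ge0.
have [bC /(psdP bC)[sC qC] eC] := opsqrtP bBB pBB.
exact: sqrt_unique.
Qed.

Lemma opabs_psd A : bounded_op A -> psd A -> opabs A = A.
Proof.
move=> bA pA; have /(psdP bA)[sA _] := pA.
by rewrite /opabs (adjE bA sA) opsqrtE.
Qed.

End SquareRoot.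

(** * Nonnegative sums over arbitrary index sets *)

Section Esum.
Variables (R : realType) (T : choiceType).
Implicit Types (I : set T) (f : T -> R).

Lemma fset_seq I (F : set T) : fsets I F -> exists s : seq T,
  [/\ uniq s, forall x, x \in s -> I x & F = [set` s]].
Proof.
move=> [/finite_seqP[s sE] FI]; exists (undup s); split; first exact: undup_uniq.
  by move=> x; rewrite mem_undup => xs; apply: FI; rewrite sE.
by rewrite sE; apply/seteqP; split=> x /=; rewrite mem_undup.
Qed.

Lemma esum_le_seq I f (x : R) :
  (forall s, uniq s -> (forall e, e \in s -> I e) -> \sum_(e <- s) f e <= x) ->
  (\esum_(e in I) (f e)%:E <= x%:E)%E.
Proof.
move=> h; apply: ge_ereal_sup => _ [F IF <-].
have [s [us sI ->]] := fset_seq IF.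
by rewrite -fsbig_seq //= sumEFin lee_fin h.
Qed.

Lemma esum_ge_seq I f s : uniq s -> (forall e, e \in s -> I e) ->
  ((\sum_(e <- s) f e)%:E <= \esum_(e in I) (f e)%:E)%E.
Proof.
move=> us sI; apply: esum_ge; exists [set` s]; last by rewrite -fsbig_seq //= sumEFin.
by split; [apply/finite_seqP; exists s|move=> x /sI].
Qed.

End Esum.

Lemma esum_swap (R : realType) (T1 T2 : choiceType) (I : set T1) (J : set T2)
  (a : T1 -> T2 -> \bar R) : (forall i j, (0 <= a i j)%E) ->
  (\esum_(i in I) \esum_(j in J) a i j = \esum_(j in J) \esum_(i in I) a i j)%E.
Proof.
move=> a0; rewrite !esum_esum //.
rewrite (reindex_esum (J `*`` (fun=> I)) _ (fun x => (x.2, x.1))) //; split=> //=.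
- by move=> [i j] [].
- by move=> [i1 i2] [j1 j2] /= _ _ [] -> ->.
- by move=> [i1 i2] [Pi1 Qi2] /=; exists (i2, i1).
Qed.

(** * Orthonormal bases and Hilbert-Schmidt norms *)

Section Basis.
Variables (R : realType) (H : hilbert R).
Implicit Types (u v w : H) (A B X D : op H) (E S : set H).

Lemma lspan_lin S (a : R[i]) u v : lspan S u -> lspan S v -> lspan S (a *: u + v).
Proof.
move=> [n [b [s [hs ->]]]] [m [c [t [ht ->]]]].
exists (n + m)%N, (fun i => match fintype.split i with inl j => a * b j | inr j => c j end),
  (fun i => match fintype.split i with inl j => s j | inr j => t j end); split.
  by move=> i; case: (fintype.split i).
rewrite big_split_ord /= scaler_sumr; congr (_ + _); apply: eq_bigr => i _.
  have -> : fintype.split (lshift m i) = inl i by exact: (unsplitK (inl _ i)).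
  by rewrite scalerA.
by have -> : fintype.split (rshift n i) = inr i by exact: (unsplitK (inr _ i)).
Qed.

Lemma lspan0 S : lspan S 0.
Proof.
exists 0%N, (fun=> 0), (fun=> 0); split; first by case.
by rewrite big_ord0.
Qed.

Lemma lspan_mem S u : S u -> lspan S u.
Proof.
move=> Su; exists 1%N, (fun=> 1), (fun=> u); split => //.
by rewrite big_ord1 scale1r.
Qed.

Definition closed_span S := [set u | forall e : R, 0 < e -> exists2 v, lspan S v & hnorm (u - v) < e].

Lemma subspace_closed_span S : subspace (closed_span S).
Proof.
split.
- by move=> e e0; exists 0; [exact: lspan0|rewrite subrr hnorm0].
- move=> a u v hu hv e e0.
  have c0 : 0 < complex.Re `|a| + 1.
    by rewrite ltr_wpDl //; have := normr_ge0 a; rewrite lecE => /andP[].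
  have [|u' su' uu'] := hu (e / 2 / (complex.Re `|a| + 1)); first by rewrite !divr_gt0.
  have [|v' sv' vv'] := hv (e / 2); first by rewrite !divr_gt0.
  exists (a *: u' + v'); first exact: lspan_lin.
  rewrite opprD addrACA -scalerBr; apply: le_lt_trans (ler_hnormD _ _) _.
  rewrite [e]splitr; apply: ler_ltD => //; rewrite hnormZc.
  move: uu'; rewrite ltr_pdivlMr // => /ltW; apply: le_trans.
  by rewrite mulrC ler_wpM2l ?hnorm_ge0 ?lerDl.
- move=> u hu e e0; have e20 : 0 < e / 2 by rewrite divr_gt0.
  have [v hv uv] := hu _ e20; have [w sw vw] := hv _ e20.
  exists w => //; rewrite (subr_split _ _ v) [e]splitr.
  by apply: le_lt_trans (ler_hnormD _ _) _; apply: ltrD.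
Qed.

Definition orthonormal_set E :=
  (forall e, E e -> hdot H e e = 1) /\
  (forall e f, E e -> E f -> e <> f -> hdot H e f = 0).

(** A maximal orthonormal set has dense span: a vector outside the closed span leaves a nonzero
    residual under projection, and normalizing it would enlarge the set. *)
Lemma basis_exists : exists E, orthonormal_basis (E : set H).
Proof.
have [|E [[E1 E2] Emax]] := @Zorn_bigcup H orthonormal_set.
  move=> F FP tot; split=> [e [X FX Xe]|e f [X FX Xe] [Y FY Yf] ef].
    by have [h _] := FP _ FX; apply: h.
  have [XY|YX] := tot X Y FX FY.
    by have [_ h] := FP _ FY; apply: h => //; apply: XY.
  by have [_ h] := FP _ FX; apply: h => //; apply: YX.
exists E; split=> //; apply/denseP => u.
apply: contrapT => hu.
have [p Mp ort] := projection u (subspace_closed_span E).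
have z0 : u - p != 0.
  by apply/eqP => /eqP; rewrite subr_eq0 => /eqP up; apply: hu; rewrite up; apply: Mp.
set z := u - p in ort z0.
have n0 : hnorm z != 0 by apply: contra_neq z0; apply: hnorm_eq0.
pose f := ((hnorm z)^-1)%:C%C *: z.
have f1 : hdot H f f = 1.
  by rewrite hdot_uu ipZl ipZr ipuu; congr (_%:C%C); field.
have zE e : E e -> hdot H z e = 0.
  move=> Ee; apply: ort => d d0; exists e; first exact: lspan_mem.
  by rewrite subrr hnorm0.
have fE e : E e -> hdot H f e = 0 by move=> Ee; rewrite hdotZl zE // mulr0.
have nEf : ~ E f by move=> Ef; have := f1; rewrite fE // => /eqP; rewrite eq_sym oner_eq0.
apply: (Emax (E `|` [set f])).
  split; first by move=> e Ee; left.
  by move=> h; apply: nEf; apply: h; right.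
split=> [e [|->]|e g [Ee|->] [Eg|->]] //; first exact: E1.
- exact: E2.
- by move=> _; rewrite hdotC fE // conjC0.
- by move=> _; rewrite fE.
Qed.

Lemma hbasisP : orthonormal_basis (@hbasis R H).
Proof. exact: (getPex basis_exists). Qed.

(** The squared modulus of <u, v>, kept real so that its sums can be taken in the extended reals. *)
Definition csq u v : R := complex.Re (hdot H u v) ^+ 2 + complex.Im (hdot H u v) ^+ 2.

Lemma csq_ge0 u v : 0 <= csq u v.
Proof. by rewrite addr_ge0 ?sqr_ge0. Qed.

Lemma csqC u v : csq u v = csq v u.
Proof. by rewrite /csq hdotC Re_conj Im_conj sqrrN. Qed.

Lemma csqE u v : hdot H u v * hdot H v u = (csq u v)%:C%C.
Proof.
rewrite (hdotC v u) /csq; apply: complex_ext.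
  rewrite Re_mul Re_conj Im_conj /=; ring.
rewrite Im_mul Re_conj Im_conj /=; ring.
Qed.

Lemma bessel_proj E s u : orthonormal_set E -> uniq s -> (forall e, e \in s -> E e) ->
  let p := \sum_(e <- s) hdot H u e *: e in
  (forall e, e \in s -> hdot H (u - p) e = 0) /\
  ip (u - p) (u - p) = ip u u - \sum_(e <- s) csq u e.
Proof.
move=> [E1 E2] us sE p.
have sum_dot v w : hdot H (\sum_(e <- s) hdot H v e *: e) w = \sum_(e <- s) hdot H v e * hdot H e w.
  rewrite -[LHS]/((applyr (hdot H) w) _) raddf_sum; apply: eq_bigr => e _.
  by rewrite /applyr /= hdotZl.
have ort e : e \in s -> hdot H (u - p) e = 0.
  move=> es; rewrite hdotBl sum_dot (bigD1_seq e) //= (E1 _ (sE _ es)) mulr1.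
  rewrite big_seq_cond big1 ?addr0 ?subrr //.
  by move=> f /andP[fs /eqP fe]; rewrite (E2 _ _ (sE _ fs) (sE _ es) fe) mulr0.
split=> //.
have ortp : hdot H (u - p) p = 0.
  rewrite hdotC sum_dot big_seq big1 ?conjC0 // => e es.
  by rewrite (hdotC e) ort // conjC0 mulr0.
rewrite /ip hdotBr ortp subr0 hdotBl sum_dot.
under eq_bigr do rewrite csqE.
by rewrite Re_add Re_opp -/(ip u u) Re_sum.
Qed.

(** One inequality is Bessel's. For the other, the projection onto the finitely many basis vectors
    of an approximant w is at least as close to u as w is. *)
Lemma parseval E u : orthonormal_basis E ->
  (\esum_(e in E) (csq u e)%:E = (ip u u)%:E)%E.
Proof.
move=> [E1 E2 /denseP Ed]; apply: le_anti; apply/andP; split.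
  apply: esum_le_seq => s us sE.
  have [_ h] := bessel_proj u (conj E1 E2) us sE.
  by rewrite -subr_ge0 -h ip_ge0.
apply/lee_addgt0Pr => e e0.
have [v [n [a [t [tE ->]]]] hv] := Ed u (Num.sqrt e) ltac:(by rewrite sqrtr_gt0).
pose s := undup (codom t).
have us : uniq s by apply: undup_uniq.
have sE f : f \in s -> E f by rewrite mem_undup => /codomP[i ->].
have [ort hp] := bessel_proj u (conj E1 E2) us sE.
set p := \sum_(_ <- _) _ in ort hp; set w := \sum_(_ < _) _ in hv.
apply: le_trans (_ : (\sum_(f <- s) csq u f)%:E + e%:E <= _)%E; last first.
  by rewrite leeD2r // esum_ge_seq.
rewrite -EFinD lee_fin -lerBlDl -hp.
(* Both p and w are combinations of vectors of s, to which the residual u - p is orthogonal. *)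
have wort : hdot H (u - p) (p - w) = 0.
  rewrite hdotBr; apply/eqP; rewrite subr_eq0.
  have sum_r (I : Type) (r : seq I) (c : I -> R[i]) (x : I -> H) :
      hdot H (u - p) (\sum_(i <- r) c i *: x i) = \sum_(i <- r) Num.conj (c i) * hdot H (u - p) (x i).
    by rewrite raddf_sum; apply: eq_bigr => i _; exact: hdotZr.
  rewrite !sum_r big_seq !big1 // => [i _|i /ort ->]; last by rewrite mulr0.
  by rewrite ort ?mulr0 // mem_undup codom_f.
have hlt : ip (u - w) (u - w) < e.
  rewrite ipuu -[ltRHS]sqr_sqrtr ?ltW // ltr_pXn2r ?nnegrE ?hnorm_ge0 ?sqrtr_ge0 //.
apply: le_trans (ltW hlt); rewrite (subr_split u w p).
move: (u - p) (p - w) wort => x y /(congr1 (@complex.Re R)); rewrite -/(ip x y) /= => xy.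
by rewrite !(ipDl, ipDr) (ipC y) xy !addr0 add0r lerDl ip_ge0.
Qed.

(** The squared Hilbert-Schmidt norm, possibly infinite; the trace of a positive operator is its
    value at the square root. *)
Definition hs2 A : \bar R := (\esum_(e in @hbasis R H) (ip (A e) (A e))%:E)%E.

(** Parseval expands both sides into the same double sum of |<A e, f>|^2, and the order of summation
    can be exchanged. Later this plays the role of cyclicity. *)
Lemma hs2_adjoint A A' : adjoint A A' -> hs2 A = hs2 A'.
Proof.
move=> hA; rewrite /hs2.
transitivity (\esum_(e in @hbasis R H) \esum_(f in @hbasis R H) (csq (A e) f)%:E)%E.
  by apply: eq_esum => e _; rewrite parseval //; apply: hbasisP.
rewrite esum_swap; last by move=> e f; rewrite lee_fin csq_ge0.
apply: eq_esum => f _; rewrite -(parseval _ hbasisP); apply: eq_esum => e _.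
by rewrite (csqC (A' f)) /csq hA.
Qed.

Lemma hs2_ge0 A : (0 <= hs2 A)%E.
Proof. by apply: esum_ge0 => e _; rewrite lee_fin ip_ge0. Qed.

End Basis.

(** * The trace norm *)

Section TraceNorm.
Variables (R : realType) (H : hilbert R).
Implicit Types (u v w : H) (A B C X D : op H).

Lemma projection_op (M : set H) : subspace M -> exists p : op H,
  [/\ bounded_op p, selfadj p, (forall u, M (p u))
    & forall u m, M m -> hdot H (u - p u) m = 0].
Proof.
move=> sM; have [_ Ml _] := sM.
have h u : exists q, M q /\ forall m, M m -> hdot H (u - q) m = 0.
  by have [q Mq hq] := projection u sM; exists q.
have [p hp] := choice h.
have Mp u : M (p u) by have [] := hp u.
have ort u m : M m -> hdot H (u - p u) m = 0 by have [_] := hp u; apply.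
have pdot u m : M m -> hdot H (p u) m = hdot H u m.
  by move=> /(ort u)/eqP; rewrite hdotBl subr_eq0 => /eqP.
have ippp u : ip (p u) (p u) = ip u (p u) by rewrite /ip pdot.
have bp : bounded_op p.
  split=> [a u v|].
    (* The defect of linearity lies in M and is orthogonal to M, hence to itself. *)
    pose d := (-1) *: (a *: p u + p v) + p (a *: u + v).
    have Md : M d by apply: (Ml) => //; apply: (Ml).
    have d0 : d = 0.
      apply: ip_eq0; rewrite /ip {1}/d hdotDl pdot // !(hdotZl, hdotDl) !pdot //.
      by rewrite mulN1r addNr.
    by move: d0; rewrite /d scaleN1r addrC => /eqP; rewrite subr_eq0 => /eqP.
  exists 1 => u; rewrite mul1r; have := ip_le u (p u); rewrite -ippp ipuu.
  have [->|n0] := eqVneq (hnorm (p u)) 0; first by rewrite hnorm_ge0.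
  by rewrite expr2 ler_pM2r // lt_neqAle eq_sym n0 hnorm_ge0.
exists p; split=> // u v.
by rewrite hdotC -pdot // -hdotC pdot.
Qed.

Lemma etrE A : etr A = (\esum_(e in @hbasis R H) (ip (A e) e)%:E)%E.
Proof. by []. Qed.

Lemma etr_sqr C : selfadj C -> etr (C \o C) = hs2 C.
Proof. by move=> sC; apply: eq_esum => e _; rewrite /= -[complex.Re _]/(ip _ _) selfadj_ip. Qed.

Lemma psd_sqr C : selfadj C -> bounded_op C -> psd (C \o C).
Proof.
move=> sC bC; apply/psdP; first exact: bounded_comp.
split; first exact: (adjoint_comp sC sC).
by move=> u /=; rewrite (selfadj_ip _ _ sC) ip_ge0.
Qed.

Lemma ip_hs A C u : selfadj C -> C \o C = A -> ip (A u) u = ip (C u) (C u).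
Proof. by move=> sC <- /=; rewrite selfadj_ip. Qed.

(** [opsqrt] is only a chosen root; uniqueness identifies it with the constructed one, which
    commutes with everything that commutes with X^2. *)
Lemma opabs_selfadj X : bounded_op X -> selfadj X ->
  [/\ bounded_op (opabs X), selfadj (opabs X), pos (opabs X),
      opabs X \o opabs X = X \o X & X \o opabs X = opabs X \o X].
Proof.
move=> bX sX; rewrite /opabs (adjE bX sX).
have bXX : bounded_op (X \o X) by apply: bounded_comp.
have pXX := psd_sqr sX bX.
have [bB pB BB] := opsqrtP bXX pXX; have /(psdP bB)[sB qB] := pB.
split=> //; have /(psdP bXX)[sXX qXX] := pXX.
have [C [bC sC pC CC com]] := sqrt_exists bXX sXX qXX.
have -> : opsqrt (X \o X) = C by apply: sqrt_unique => //; rewrite BB CC.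
exact: com.
Qed.

(** Passing to adjoints moves p and 1 - p to the left of C, where Pythagoras applies to each vector
    C e. *)
Lemma hs2_split (p C : op H) : bounded_op p -> selfadj p ->
  bounded_op C -> selfadj C ->
  (forall u, hdot H (u - p u) (p u) = 0) ->
  hs2 C = (hs2 (C \o p) + hs2 (C \o ((id : op H) - p)%R))%E.
Proof.
move=> bp sp bC sC ort; pose q := (id : op H) - p.
have sq : selfadj q by apply: selfadj_sub => //; apply: selfadj_id.
rewrite (hs2_adjoint (adjoint_comp sC sp)) (hs2_adjoint (adjoint_comp sC sq)).
rewrite -esumD => [|e _|e _]; try by rewrite lee_fin ip_ge0.
apply: eq_esum => e _; rewrite -EFinD; congr (_%:E) => /=.
rewrite -[q (C e)]/(C e - p (C e)).
have := ort (C e) => /(congr1 (@complex.Re R)); rewrite -/(ip _ _) /=.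
move: (C e) => x h; have -> : ip x x = ip ((x - p x) + p x) ((x - p x) + p x) by rewrite subrK.
move: h; move: (x - p x) => y; move: (p x) => z yz.
by rewrite !(ipDl, ipDr) (ipC z) yz; ring.
Qed.

(* On [ker (|X| - X)], |X| coincides with X, and on its orthogonal complement with - X. *)
Lemma etr_opabs_le X D : bounded_op X -> selfadj X ->
  bounded_op D -> selfadj D -> pos D ->
  (forall u, ip (X u) u <= ip (D u) u) -> (forall u, - ip (X u) u <= ip (D u) u) ->
  (etr (opabs X) <= etr D)%E.
Proof.
move=> bX sX bD sD pD XD NXD.
have [bB sB pB BB XB] := opabs_selfadj bX sX.
set B := opabs X in bB sB pB BB XB *.
have [b [bb sb _ bE _]] := sqrt_exists bB sB pB.
have [d [bd sd _ dE _]] := sqrt_exists bD sD pD.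
have bBX : bounded_op (B - X) by apply: bounded_sub.
have [p [bp sp Mp ort]] := projection_op (subspace_ker bBX).
have ortp u : hdot H (u - p u) (p u) = 0 by apply: ort; apply: Mp.
have Bp u : B (p u) = X (p u).
  by apply/eqP; rewrite -subr_eq0; apply/eqP; apply: Mp.
(* Since B and X commute and have equal squares, (B - X) (B + X) = 0: the range of B + X lies in the
   kernel, to which u - p u is orthogonal. *)
have Bq u : B (u - p u) = - X (u - p u).
  apply/eqP; rewrite -subr_eq0 opprK; apply/eqP/hdot_ext => w.
  rewrite hdot0r hdotDr -sB -sX -hdotDl hdotC.
  rewrite ort ?conjC0 //= opaddE opoppE (bopD bB) (bopD bX).
  have /= -> := congr1 (fun f => f w) BB; have /= -> := congr1 (fun f => f w) XB.
  by rewrite [X in _ - X]addrC subrr.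
(* Both traces split along p. On the kernel the form of B is that of X, on the complement that of -
   X, and D dominates both. *)
rewrite -bE -dE !etr_sqr // (hs2_split bp sp bb sb ortp) (hs2_split bp sp bd sd ortp).
apply: leeD; apply: le_esum => e _; rewrite lee_fin /=.
  by rewrite -(ip_hs _ sb bE) -(ip_hs _ sd dE) Bp.
rewrite -[(_ - p) e]/(e - p e) -(ip_hs _ sb bE) -(ip_hs _ sd dE) Bq ipNl; exact: NXD.
Qed.

(** X and |X| have equal norms on each vector, so the comparison of forms applies to X and to -
    X. *)
Lemma form_le_opabs X u : bounded_op X -> selfadj X ->
  ip (X u) u <= ip (opabs X u) u /\ - ip (X u) u <= ip (opabs X u) u.
Proof.
move=> bX sX; have [bB sB pB BB _] := opabs_selfadj bX sX.
have nE v : ip (X v) (X v) = ip (opabs X v) (opabs X v).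
  rewrite (selfadj_ip _ _ sX) (selfadj_ip _ _ sB).
  by have /= -> := congr1 (fun f => f v) BB.
split; first exact: form_le_of_norm_eq.
rewrite -ipNl; apply: (@form_le_of_norm_eq _ _ (- X)) => //.
- exact: bounded_opp.
- exact: selfadj_opp.
- by move=> v; rewrite opoppE ipNl ipNr opprK.
Qed.

Lemma etr_ge0 A : pos A -> (0 <= etr A)%E.
Proof. by move=> pA; apply: esum_ge0 => e _; rewrite lee_fin; apply: pA. Qed.

Lemma etrD A B : pos A -> pos B -> etr (A + B) = (etr A + etr B)%E.
Proof.
move=> pA pB; rewrite !etrE -esumD => [|e _|e _]; try by rewrite lee_fin ?pA ?pB.
by apply: eq_esum => e _; rewrite -EFinD ipDl.
Qed.

(** Self-adjoint trace-class operators, the setting in which the triangle inequality is proved. *)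
Definition satc X := [/\ bounded_op X, selfadj X & (etr (opabs X) < +oo)%E].

Lemma trnorm_ge0 X : bounded_op X -> selfadj X -> 0 <= trnorm X.
Proof.
move=> bX sX; have [_ _ pB _ _] := opabs_selfadj bX sX.
by apply: fine_ge0; apply: etr_ge0.
Qed.

Lemma satc_dominated X D : bounded_op X -> selfadj X ->
  bounded_op D -> selfadj D -> pos D -> (etr D < +oo)%E ->
  (forall u, ip (X u) u <= ip (D u) u) -> (forall u, - ip (X u) u <= ip (D u) u) ->
  satc X /\ trnorm X <= fine (etr D).
Proof.
move=> bX sX bD sD pD fD h1 h2.
have le := etr_opabs_le bX sX bD sD pD h1 h2.
have f : (etr (opabs X) < +oo)%E by apply: le_lt_trans le fD.
split; first by split.
have [_ _ pB _ _] := opabs_selfadj bX sX.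
by apply: fine_le => //; rewrite ge0_fin_numE // etr_ge0.
Qed.

(** The operator |X| + |Y| dominates both X + Y and its opposite. *)
Lemma satc_add X Y : satc X -> satc Y -> satc (X + Y) /\ trnorm (X + Y) <= trnorm X + trnorm Y.
Proof.
move=> [bX sX fX] [bY sY fY].
have [bB sB pB _ _] := opabs_selfadj bX sX; have [bC sC pC _ _] := opabs_selfadj bY sY.
rewrite /trnorm -fineD ?ge0_fin_numE ?etr_ge0 // -etrD //.
apply: satc_dominated.
- exact: bounded_add.
- exact: selfadj_add.
- exact: bounded_add.
- exact: selfadj_add.
- by move=> u; rewrite ipDl addr_ge0.
- by rewrite etrD // lte_add_pinfty.
- move=> u; rewrite !ipDl; apply: lerD.
    by have [] := form_le_opabs u bX sX.
  by have [] := form_le_opabs u bY sY.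
- move=> u; rewrite !ipDl opprD; apply: lerD.
    by have [] := form_le_opabs u bX sX.
  by have [] := form_le_opabs u bY sY.
Qed.

End TraceNorm.

#[local] Existing Instance totally_filter.

(** * Traces as unordered sums *)

Section HasSum.
Variables (R : realType) (T : choiceType) (E : set T).
Implicit Types (f g : T -> R[i]) (x y : R[i]).

(** A relation that records convergence along with the value, which [sum] alone does not. *)
Definition has_sum f x :=
  partial_sum (fun e : E => f (set_val e) : R[i]^o) @ totally --> (x : R[i]^o).

Lemma has_sum_lim f x : has_sum f x -> summability.sum (fun e : E => f (set_val e) : R[i]^o) = x.
Proof. by move=> h; apply: (cvg_lim (@norm_hausdorff _ _) h). Qed.

(* A divergent sum has the junk value 0. *)
Lemma has_sum_nonzero f : summability.sum (fun e : E => f (set_val e) : R[i]^o) != 0 ->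
  has_sum f (summability.sum (fun e : E => f (set_val e) : R[i]^o)).
Proof.
move=> n0; rewrite /has_sum; have [//|h] :=
  pselect (cvg (partial_sum (fun e : E => f (set_val e) : R[i]^o) @ totally)).
by move: n0; rewrite /summability.sum (dvgP h) eqxx.
Qed.

Lemma has_sumD f g x y : has_sum f x -> has_sum g y -> has_sum (fun e => f e + g e) (x + y).
Proof.
move=> hf hg; rewrite /has_sum.
rewrite (_ : partial_sum _ = (fun A => partial_sum (fun e : E => f (set_val e) : R[i]^o) A +
  partial_sum (fun e : E => g (set_val e) : R[i]^o) A)); first exact: cvgD hf hg.
by apply: funext => A; rewrite /partial_sum /= big_split.
Qed.

Lemma has_sumZ f x y : has_sum f x -> has_sum (fun e => y * f e) (y * x).
Proof.
move=> hf; rewrite /has_sum.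
rewrite (_ : partial_sum _ = (fun A => (y : R[i]^o) *: partial_sum (fun e : E => f (set_val e) : R[i]^o) A)).
  exact: cvgZ (cvg_cst _) hf.
by apply: funext => A; rewrite /partial_sum /= scaler_sumr.
Qed.

Lemma partial_sum_seq (V : zmodType) (h : T -> V) (A : {fset E}) :
  let s := map set_val (enum_fset A) in
  [/\ uniq s, (forall e, e \in s -> E e) & partial_sum (fun e : E => h (set_val e)) A = \sum_(e <- s) h e].
Proof.
split.
- by rewrite map_inj_uniq ?fset_uniq //; apply: val_inj.
- by move=> _ /mapP[e _ ->]; apply: set_valP.
- by rewrite big_map /partial_sum big_seq_fsetE.
Qed.

Lemma sum_subset_le (h : T -> R) (s t : seq T) : uniq s -> uniq t -> {subset s <= t} ->
  (forall e, e \in t -> 0 <= h e) -> \sum_(e <- s) h e <= \sum_(e <- t) h e.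
Proof.
move=> us ut st h0; rewrite [leRHS](bigID (mem s)) /= -[X in _ <= X + _]big_filter.
rewrite (perm_big [seq x <- t | x \in s]) /=; last first.
  apply: uniq_perm; rewrite ?filter_uniq // => x; rewrite mem_filter.
  by case: (boolP (x \in s)) => //= /st ->.
rewrite lerDl big_seq_cond sumr_ge0 // => e /andP[et _]; exact: h0.
Qed.

Lemma seq_fset (s : seq T) : (forall e, e \in s -> E e) ->
  exists A : {fset E}, forall e, e \in s -> e \in map set_val (enum_fset A).
Proof.
move=> sE; exists [fset x in pmap insub s]%fset => e es.
have eE : e \in E by apply/mem_set/sE.
apply/mapP; exists (exist _ e eE) => //.
by rewrite /= in_fset_ mem_pmap_sub.
Qed.

Lemma nonneg_sums_near (h : T -> R) (s : R) : (forall e, E e -> 0 <= h e) ->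
  (\esum_(e in E) (h e)%:E = s%:E)%E -> forall d : R, 0 < d ->
  exists A : {fset E}, forall B : {fset E}, (A `<=` B)%fset ->
    `|s - partial_sum (fun e : E => h (set_val e)) B| < d.
Proof.
move=> h0 hs d d0.
have [t [ut tE td]] : exists t : seq T, [/\ uniq t, forall e, e \in t -> E e & s - d < \sum_(e <- t) h e].
  apply: contrapT => no; have : (s%:E <= (s - d)%:E)%E.
    rewrite -hs; apply: esum_le_seq => t ut tE; rewrite leNgt; apply/negP => lt.
    by apply: no; exists t.
  by rewrite lee_fin lerBrDl gerDr leNgt d0.
have [A hA] := seq_fset tE; exists A => B AB.
have [uB BE ->] := partial_sum_seq h B.
have le1 : \sum_(e <- map set_val (enum_fset B)) h e <= s.
  by rewrite -lee_fin -hs; apply: esum_ge_seq.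
have le2 : \sum_(e <- t) h e <= \sum_(e <- map set_val (enum_fset B)) h e.
  apply: sum_subset_le => // [e et|e /BE /h0 //].
  have /mapP[x xA ->] := hA e et; apply: map_f.
  by move/fsubsetP: AB; apply.
rewrite ger0_norm ?subr_ge0 //; move: td le2; lra.
Qed.

Lemma partial_sum_real (h : T -> R) A :
  partial_sum (fun e : E => (h (set_val e))%:C%C : R[i]^o) A =
  (partial_sum (fun e : E => h (set_val e)) A)%:C%C.
Proof. by rewrite /partial_sum (rmorph_sum (real_complex R)). Qed.

Lemma has_sum_nonneg (h : T -> R) (s : R) : (forall e, E e -> 0 <= h e) ->
  (\esum_(e in E) (h e)%:E = s%:E)%E -> has_sum (fun e => (h e)%:C%C) s%:C%C.
Proof.
move=> h0 hs; apply/cvgrPdist_lt => d d0.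
have dE : d = (complex.Re d)%:C%C by rewrite RRe_real // gtr0_real.
rewrite dE ltcR in d0 *.
have [A hA] := nonneg_sums_near h0 hs d0.
exists A => // B /hA /=; rewrite partial_sum_real -rmorphB /= normc_def /= expr0n addr0 sqrtr_sqr.
by rewrite ltcR.
Qed.

Lemma has_sum_nonneg_inv (h : T -> R) (x : R[i]) : (forall e, E e -> 0 <= h e) ->
  has_sum (fun e => (h e)%:C%C) x -> (\esum_(e in E) (h e)%:E = (complex.Re x)%:E)%E.
Proof.
move=> h0 /cvgrPdist_lt hx.
have bound t : uniq t -> (forall e, e \in t -> E e) -> \sum_(e <- t) h e <= complex.Re x + 1.
  move=> ut tE.
  (* Tolerance 1 is enough to bound all finite sums; the exact value comes afterwards from
     uniqueness of limits. *)
  have /= [|A _ hA] := hx 1; first by [].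
  have [B hB] := seq_fset tE.
  have := hA (A `|` B)%fset (fsubsetUl _ _); rewrite /= partial_sum_real.
  have [uC CE ->] := partial_sum_seq h (A `|` B)%fset.
  set S := \sum_(_ <- _) _ => lt.
  have le2 : \sum_(e <- t) h e <= S.
    apply: sum_subset_le => // [e et|e /CE /h0 //].
    have /mapP[y yB ->] := hB e et; apply: map_f.
    by rewrite in_fsetU yB orbT.
  have := normc_ge_Re (x - S%:C%C) => /le_lt_trans/(_ lt).
  rewrite Re_add Re_opp /= ltcR ltr_norml => /andP[lt1 _].
  by move: lt1 le2; lra.
have fin : \esum_(e in E) (h e)%:E \is a fin_num.
  rewrite ge0_fin_numE; last by apply: esum_ge0 => e Ee; rewrite lee_fin h0.
  by apply: le_lt_trans (esum_le_seq bound) _; rewrite ltry.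
have eS := fineK fin; have hs := has_sum_nonneg h0 (esym eS).
suff -> : x = (fine (\esum_(e in E) (h e)%:E))%:C%C by rewrite /= eS.
by apply: (cvg_unique _ _ hs); [exact: norm_hausdorff|apply/cvgrPdist_lt].
Qed.

End HasSum.

(** * Operator traces by polarization *)

Section Trace.
Variables (R : realType) (H : hilbert R).
Implicit Types (u v w x y : H) (A B C D X Y Z U : op H).

Definition has_tr A (z : R[i]) := has_sum (@hbasis R H) (fun e => hdot H (A e) e) z.

Lemma has_tr_tr A z : has_tr A z -> tr A = z.
Proof. exact: has_sum_lim. Qed.

Lemma has_tr_nonzero A : tr A != 0 -> has_tr A (tr A).
Proof. exact: has_sum_nonzero. Qed.

Lemma has_trD A B (z w : R[i]) : has_tr A z -> has_tr B w -> has_tr (A + B) (z + w).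
Proof.
move=> hA hB; have := has_sumD hA hB; congr (has_sum _ _ _); apply: funext => e.
by rewrite opaddE hdotDl.
Qed.

Lemma has_trZ (a : R[i]) A z : has_tr A z -> has_tr (a *: A) (a * z).
Proof.
move=> hA; have := has_sumZ (y := a) hA; congr (has_sum _ _ _); apply: funext => e.
by rewrite opscaleE hdotZl.
Qed.

Lemma psd_hdot A u : psd A -> hdot H (A u) u = (ip (A u) u)%:C%C.
Proof. by move=> pA; rewrite /ip RRe_real // ger0_real. Qed.

Lemma psd_pos A : psd A -> pos A.
Proof. by move=> pA u; have := pA u; rewrite complex_ge0 => /andP[]. Qed.

Lemma has_tr_psd A (s : R) : psd A -> etr A = s%:E -> has_tr A s%:C%C.
Proof.
move=> pA hs; have := has_sum_nonneg (fun e _ => psd_pos pA e) hs.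
by congr (has_sum _ _ _); apply: funext => e; rewrite psd_hdot.
Qed.

Lemma etr_has_tr A z : psd A -> has_tr A z -> etr A = (complex.Re z)%:E.
Proof.
move=> pA hz; apply: (has_sum_nonneg_inv (fun e _ => psd_pos pA e)).
by move: hz; congr (has_sum _ _ _); apply: funext => e; rewrite psd_hdot.
Qed.

(** Trace one forces convergence, as a divergent sum has value 0. Conversely, a positive operator is
    its own absolute value, so a convergent trace makes it trace class. *)
Lemma densityP (rho : op H) : density rho <-> [/\ bounded_op rho, psd rho & has_tr rho 1].
Proof.
split=> [[[br fr] pr tr1]|[br pr h1]].
  by split=> //; rewrite -tr1; apply: has_tr_nonzero; rewrite tr1 oner_eq0.
split=> //; last exact: has_tr_tr.
by split=> //; rewrite opabs_psd // (etr_has_tr pr h1) ltry.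
Qed.

Lemma density_etr (rho : op H) : density rho -> etr rho = 1%:E.
Proof. by move=> /densityP[_ pr h1]; rewrite (etr_has_tr pr h1). Qed.

(** Turns the convergence of a complex sum into that of four sums of nonnegative terms. *)
Lemma hdot_polar x y : hdot H x y =
  (4^-1)%:C%C * ((ip (x + y) (x + y))%:C%C - (ip (x - y) (x - y))%:C%C)
  + 'i%C * (4^-1)%:C%C * ((ip (x + 'i%C *: y) (x + 'i%C *: y))%:C%C
    - (ip (x - 'i%C *: y) (x - 'i%C *: y))%:C%C).
Proof.
rewrite hdotE !(ipDl, ipDr, ipNl, ipNr) ipii (ipC y x) (ipC ('i%C *: y) x).
apply: complex_ext; rewrite !(Re_add, Im_add, Re_mul, Im_mul, Re_opp, Im_opp) /=; field => //.
Qed.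

Lemma complex_polar (z w : R[i]) :
  let n (a : R[i]) := (complex.Re a ^+ 2 + complex.Im a ^+ 2)%:C%C in
  z * Num.conj w = (4^-1)%:C%C * (n (z + w) - n (z - w))
    + 'i%C * (4^-1)%:C%C * (n (z + 'i%C * w) - n (z - 'i%C * w)).
Proof.
move=> n; rewrite /n; apply: complex_ext;
 rewrite !(Re_add, Im_add, Re_mul, Im_mul, Re_opp, Im_opp, Re_conj, Im_conj) /=; field => //.
Qed.

Lemma has_sum_polar (E : set H) (f1 f2 f3 f4 : H -> R[i]) z1 z2 z3 z4 :
  has_sum E f1 z1 -> has_sum E f2 z2 -> has_sum E f3 z3 -> has_sum E f4 z4 ->
  has_sum E (fun e => (4^-1)%:C%C * (f1 e - f2 e) + 'i%C * (4^-1)%:C%C * (f3 e - f4 e))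
    ((4^-1)%:C%C * (z1 - z2) + 'i%C * (4^-1)%:C%C * (z3 - z4)).
Proof.
move=> h1 h2 h3 h4; apply: has_sumD; apply: has_sumZ.
  by have := has_sumD h1 (has_sumZ (y := -1) h2); rewrite mulN1r; under eq_fun do rewrite mulN1r.
by have := has_sumD h3 (has_sumZ (y := -1) h4); rewrite mulN1r; under eq_fun do rewrite mulN1r.
Qed.

Definition rank1 u v : op H := fun x => hdot H x v *: u.

Lemma bounded_rank1 u v : bounded_op (rank1 u v).
Proof.
split=> [a x y|]; first by rewrite /rank1 hdotDl hdotZl scalerDl scalerA.
(* The factor 2 is crude: real and imaginary parts of <x, v> are each bounded by |x| |v|. *)
exists (2 * hnorm v * hnorm u) => x; rewrite /rank1 hnormZc mulrAC ler_wpM2r ?hnorm_ge0 //.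
have le y : `|ip x y| <= hnorm x * hnorm y.
  by rewrite ler_norml lerNl -ipNr -{1}(hnormN y) !ip_le.
have := le v; have := le ('i%C *: v); rewrite hnormi hdotE => h1 h2.
rewrite normc_def /= -[leLHS]ger0_norm ?sqrtr_ge0 // -ler_sqr ?nnegrE ?mulr_ge0 ?hnorm_ge0 //.
rewrite real_normK ?num_real // sqr_sqrtr ?addr_ge0 ?sqr_ge0 //.
rewrite -(real_normK (num_real (ip x v))) -(real_normK (num_real (ip x _))).
have := normr_ge0 (ip x v); have := normr_ge0 (ip x ('i%C *: v)).
move: `|ip x v| `|_| (hnorm x) (hnorm v) (hnorm_ge0 x) (hnorm_ge0 v) h1 h2 => a b c d; nra.
Qed.

Lemma parseval_dot x v : has_sum (@hbasis R H) (fun e => hdot H x e * hdot H e v) (hdot H x v).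
Proof.
have P w := has_sum_nonneg (fun e _ => csq_ge0 w e) (parseval w (@hbasisP R H)).
have := has_sum_polar (P (x + v)) (P (x - v)) (P (x + 'i%C *: v)) (P (x - 'i%C *: v)).
rewrite -hdot_polar; congr (has_sum _ _ _); apply: funext => e.
by rewrite (hdotC e v) complex_polar /csq !(hdotDl, hdotNl, hdotZl).
Qed.

(** By the polarized Parseval identity. Rank-one test operators thus recover the matrix elements of
    A from its traces. *)
Lemma tr_rank1 A u v : bounded_op A -> tr (A \o rank1 u v) = hdot H (A u) v.
Proof.
move=> bA; apply: has_tr_tr; have := parseval_dot (x := A u) (v := v); congr (has_sum _ _ _).
by apply: funext => e; rewrite /= /rank1 (bopZ bA) hdotZl mulrC.
Qed.

Lemma psd_rank1 u : psd (rank1 u u).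
Proof.
by move=> x; rewrite /rank1 hdotZl csqE ler0c csq_ge0.
Qed.

(** The adjoint of C Z is the adjoint of Z applied after C, and a bounded operator on the left costs
    only its squared bound. *)
Lemma hs2_comp_fin C Z : bounded_op C -> selfadj C -> (hs2 C < +oo)%E -> bounded_op Z ->
  (hs2 (C \o Z) < +oo)%E.
Proof.
move=> bC sC fC bZ; have [bZ' hZ'] := adjP bZ.
rewrite (hs2_adjoint (adjoint_comp sC hZ')).
have fin : hs2 C \is a fin_num by rewrite ge0_fin_numE // hs2_ge0.
have [M [M0 hM]] := bop_bound bZ'.
apply: (@le_lt_trans _ _ (M ^+ 2 * fine (hs2 C))%:E); last exact: ltry.
apply: esum_le_seq => s us sE.
apply: (@le_trans _ _ (\sum_(e <- s) M ^+ 2 * ip (C e) (C e))).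
  apply: ler_sum => e _; rewrite !ipuu -exprMn ler_pXn2r ?nnegrE ?hnorm_ge0 ?mulr_ge0 ?hnorm_ge0 ?(ltW M0) //.
  exact: hM.
rewrite -mulr_sumr ler_wpM2l ?sqr_ge0 // -lee_fin fineK //.
exact: esum_ge_seq.
Qed.

Definition hsn C Y (a : R[i]) : R := fine (hs2 (C \o (Y + a *: (id : op H)))).

(* Polarization of the diagonal terms [<C Y e, C e>] of [C C Y]. *)
Definition trform C Y : R[i] :=
  (4^-1)%:C%C * ((hsn C Y 1)%:C%C - (hsn C Y (-1))%:C%C)
  + 'i%C * (4^-1)%:C%C * ((hsn C Y 'i%C)%:C%C - (hsn C Y (- 'i%C))%:C%C).

Lemma has_tr_trform C Y : bounded_op C -> selfadj C -> (hs2 C < +oo)%E -> bounded_op Y ->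
  has_tr (C \o C \o Y) (trform C Y).
Proof.
move=> bC sC fC bY.
have P a : has_sum (@hbasis R H) (fun e => (ip (C (Y e + a *: e)) (C (Y e + a *: e)))%:C%C) (hsn C Y a)%:C%C.
  apply: (has_sum_nonneg (h := fun e => ip (C (Y e + a *: e)) (C (Y e + a *: e)))) => [e _|].
    exact: ip_ge0.
  rewrite fineK // ge0_fin_numE ?hs2_ge0 //; apply: hs2_comp_fin => //.
  by apply: bounded_add => //; apply: bounded_scale; apply: bounded_id.
have := has_sum_polar (P 1) (P (-1)) (P 'i%C) (P (- 'i%C)); congr (has_sum _ _ _).
apply: funext => e /=; rewrite sC hdot_polar.
by rewrite !(bopD bC) !scaleN1r !scaleNr !(bopN bC) !(bopZ bC) !scale1r.
Qed.

Lemma hs2_isometry X U U' : adjoint U U' -> U' \o U = id -> hs2 (U \o X) = hs2 X.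
Proof.
move=> hU U'U; apply: eq_esum => e _; congr (_%:E).
by rewrite /ip /= hU; have /= -> := congr1 (fun f => f (X e)) U'U.
Qed.

Lemma hs2_conjugate C U U' : selfadj C -> adjoint U U' -> U' \o U = id ->
  hs2 (U \o C \o U') = hs2 C.
Proof.
move=> sC hU U'U; rewrite (_ : _ \o U' = U \o (C \o U')) // (hs2_isometry _ hU U'U).
by rewrite (hs2_adjoint (adjoint_comp sC (adjoint_sym hU))) (hs2_isometry _ hU U'U).
Qed.

(** Replaces cyclicity of the trace: scalars commute with U, so the two Hilbert-Schmidt norms to be
    compared differ only by unitary factors on the left and on the right. *)
Lemma trform_unitary C Y U U' : bounded_op C -> bounded_op Y ->
  bounded_op U -> bounded_op U' -> adjoint U U' -> U' \o U = id -> U \o U' = id ->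
  trform (U \o C \o U') Y = trform C (U' \o Y \o U).
Proof.
move=> bC bY bU bU' hU U'U UU'.
suff n a : hsn (U \o C \o U') Y a = hsn C (U' \o Y \o U) a by rewrite /trform !n.
rewrite /hsn; congr fine; pose Z : op H := Y + a *: (id : op H).
have bZ : bounded_op Z by apply: bounded_add => //; apply: bounded_scale; apply: bounded_id.
pose X := C \o U' \o Z.
have bX : bounded_op X by apply: bounded_comp => //; apply: bounded_comp.
have [bX' hX] := adjP bX.
rewrite (_ : _ \o _ = U \o X) //; rewrite (hs2_isometry _ hU U'U).
rewrite (_ : C \o _ = X \o U); last first.
  apply: funext => e /=; congr (C _); rewrite /Z !opaddE !opscaleE (bopD bU') (bopZ bU') /=.
  by have /= -> := congr1 (fun f => f e) U'U.
rewrite (hs2_adjoint hX) (hs2_adjoint (adjoint_comp hX hU)).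
by rewrite (hs2_isometry _ (adjoint_sym hU) UU').
Qed.

(** Passing to adjoints puts Y to the left of C. The cross term of |(Y + conj a) C e|^2 is 2 Re (a
    <Y C e, C e>): it vanishes for a = i and a = - i, and the difference between a = 1 and a = -1 is
    nonnegative. *)
Lemma trform_psd C Y : bounded_op C -> selfadj C -> (hs2 C < +oo)%E -> bounded_op Y -> psd Y ->
  0 <= trform C Y.
Proof.
move=> bC sC fC bY pY; have /(psdP bY)[sY qY] := pY.
have nE a : hs2 (C \o (Y + a *: (id : op H))) = hs2 ((Y + Num.conj a *: (id : op H)) \o C).
  apply: hs2_adjoint; apply: adjoint_comp => //; apply: adjoint_add => //.
  exact: adjoint_scale.
have ei : hsn C Y 'i%C = hsn C Y (- 'i%C).
  rewrite /hsn !nE; congr fine; apply: eq_esum => e _; congr (_%:E) => /=.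
  rewrite !opaddE !opscaleE.
  have conj_i : Num.conj ('i%C : R[i]) = - 'i%C.
    by apply: complex_ext; rewrite ?Re_conj ?Im_conj ?Re_opp ?Im_opp /= ?oppr0.
  rewrite conj_i rmorphN /= conj_i opprK scaleNr.
  have h : ip (Y (C e)) ('i%C *: C e) = 0.
    have := psd_hdot (C e) pY; rewrite hdotE => /(congr1 (@complex.Im R)) //.
  by rewrite !(ipDl, ipDr, ipNl, ipNr) !(ipC ('i%C *: _)) h; ring.
have le1 : hsn C Y (-1) <= hsn C Y 1.
  have bid a : bounded_op (Y + a *: (id : op H)).
    by apply: bounded_add => //; apply: bounded_scale; apply: bounded_id.
  have fin a : hs2 (C \o (Y + a *: (id : op H))) \is a fin_num.
    by rewrite (ge0_fin_numE (hs2_ge0 _)); exact: hs2_comp_fin.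
  rewrite /hsn; apply: fine_le => //.
  rewrite !nE rmorphN1 rmorph1; apply: le_esum => e _; rewrite lee_fin /=.
  rewrite !opaddE !opscaleE scaleN1r scale1r !(ipDl, ipDr, ipNl, ipNr) !(ipC (C e)).
  by have := qY (C e); lra.
rewrite /trform ei subrr mulr0 addr0 -rmorphB -rmorphM ler0c mulr_ge0 //.
by rewrite subr_ge0.
Qed.

End Trace.

(** * Tensor products of operators *)

Section Extension.
Variables (R : realType) (E : hilbert R).
Variables (Gr : E -> E -> Prop) (M : R).
Hypothesis Gr_lin : forall (a : R[i]) v w v' w', Gr v w -> Gr v' w' -> Gr (a *: v + v') (a *: w + w').
Hypothesis Gr_dense : forall v (e : R), 0 < e -> exists v' w', Gr v' w' /\ hnorm (v - v') < e.
Hypothesis M0 : 0 < M.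
Hypothesis Gr_bound : forall v w, Gr v w -> hnorm w <= M * hnorm v.

Let Cl v w := forall e : R, 0 < e -> exists v' w', [/\ Gr v' w', hnorm (v - v') < e & hnorm (w - w') < e].

Let Gr_sub v w v' w' : Gr v w -> Gr v' w' -> Gr (v - v') (w - w').
Proof.
by move=> h h'; have := Gr_lin (-1) h' h; rewrite !scaleN1r (addrC _ v) (addrC _ w).
Qed.

Let Cl_exists v : exists w, Cl v w.
Proof.
have h (n : nat) : exists p : E * E, Gr p.1 p.2 /\ hnorm (v - p.1) < n.+1%:R^-1.
  by have [|v' [w' h]] := @Gr_dense v n.+1%:R^-1; [rewrite invr_gt0|exists (v', w')].
have [p hp] := choice h.
have [w hw] : exists w, hlim (fun n => (p n).2) w.
  apply: hcauchy_lim => e e0.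
  have [|N hN] := @exists_natSinv_lt R (e / (2 * M)); first by rewrite divr_gt0 // mulr_gt0.
  exists N => m n Nm Nn; have [Gm hm] := hp m; have [Gn hn] := hp n.
  apply: le_lt_trans (Gr_bound (Gr_sub Gm Gn)) _.
  have -> : (p m).1 - (p n).1 = (v - (p n).1) - (v - (p m).1).
    by rewrite opprB [RHS]addrC -subr_split.
  apply: le_lt_trans (_ : M * (hnorm (v - (p n).1) + hnorm (v - (p m).1)) < _).
    by rewrite ler_wpM2l ?ler_hnormB // ltW.
  have := lt_trans hm (hN _ Nm); have := lt_trans hn (hN _ Nn).
  rewrite !ltr_pdivlMr ?mulr_gt0 //; move: (hnorm _) (hnorm _) => a b; lra.
exists w => e e0; have [N hN] := hw e e0; have [K hK] := exists_natSinv_lt e0.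
have [Gn hn] := hp (maxn N K).
exists (p (maxn N K)).1, (p (maxn N K)).2; split=> //.
  exact: lt_trans hn (hK _ (leq_maxr _ _)).
by rewrite hnormB; apply: hN; apply: leq_maxl.
Qed.

Let Cl_lin (a : R[i]) v w v' w' : Cl v w -> Cl v' w' -> Cl (a *: v + v') (a *: w + w').
Proof.
move=> h h' e e0; have c0 : 0 < complex.Re `|a| + 1.
  by rewrite ltr_wpDl //; have := normr_ge0 a; rewrite lecE => /andP[].
have [|x [y [xy vx wy]]] := h (e / 2 / (complex.Re `|a| + 1)); first by rewrite !divr_gt0.
have [|x' [y' [xy' vx' wy']]] := h' (e / 2); first by rewrite divr_gt0.
have main (r s r' s' : E) : hnorm (r - s) < e / 2 / (complex.Re `|a| + 1) ->
    hnorm (r' - s') < e / 2 -> hnorm (a *: r + r' - (a *: s + s')) < e.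
  move=> h1 h2; rewrite opprD addrACA -scalerBr; apply: le_lt_trans (ler_hnormD _ _) _.
  rewrite [e]splitr; apply: ler_ltD => //; rewrite hnormZc.
  move: h1; rewrite ltr_pdivlMr // => /ltW; apply: le_trans.
  by rewrite mulrC ler_wpM2l ?hnorm_ge0 ?lerDl.
by exists (a *: x + x'), (a *: y + y'); split; [exact: Gr_lin|exact: main|exact: main].
Qed.

Let Cl_bound v w : Cl v w -> hnorm w <= M * hnorm v.
Proof.
move=> h; rewrite -subr_le0; apply: (@le0_of_small _ _ (M + 1)) => e e0.
have [x [y [xy vx wy]]] := h e e0.
have h1 := Gr_bound xy; have h2 := ler_hnormD (w - y) y; rewrite subrK in h2.
have h3 := ler_hnormB v (v - x); rewrite subKr in h3.
have h4 : M * hnorm x <= M * (hnorm v + e).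
  by rewrite ler_wpM2l ?(ltW M0) //; apply: le_trans h3 _; rewrite lerD2l ltW.
move: h4 h1 h2 wy; rewrite mulrDr mulrDl mul1r.
move: (M * hnorm x) (M * hnorm v) (M * e) (hnorm w) (hnorm y) (hnorm _) => a b c d f g; lra.
Qed.

Let Cl_fun v w w' : Cl v w -> Cl v w' -> w = w'.
Proof.
move=> h h'; have := Cl_bound (Cl_lin (-1) h' h).
rewrite !scaleN1r addNr hnorm0 mulr0 => le0; apply/esym/eqP; rewrite -subr_eq0 -oppr_eq0 opprB addrC.
by apply/eqP/hnorm_eq0/le_anti; rewrite le0 hnorm_ge0.
Qed.

(** The data is a linear relation because a vector has many expressions as a sum of simple tensors.
    The bound makes its closure single-valued, and density with completeness makes it everywhere
    defined. *)
Lemma bounded_extension : exists Z : op E, bounded_op Z /\ forall v w, Gr v w -> Z v = w.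
Proof.
have [Z hZ] := choice Cl_exists.
exists Z; split; last first.
  move=> v w vw; apply: Cl_fun (hZ v) _ => e e0.
  by exists v, w; rewrite !subrr hnorm0.
split; first by move=> a u v; apply: Cl_fun (hZ _) _; apply: Cl_lin.
by exists M => u; apply: Cl_bound.
Qed.

End Extension.

Section TensorLeft.
Variables (R : realType) (H G P : hilbert R) (m : H -> G -> P).
Hypothesis mDl : forall a a' b, m (a + a') b = m a b + m a' b.
Hypothesis mDr : forall a b b', m a (b + b') = m a b + m a b'.
Hypothesis mZl : forall c a b, m (c *: a) b = c *: m a b.
Hypothesis mZr : forall c a b, m a (c *: b) = c *: m a b.
Hypothesis m_dot : forall a b c d, hdot P (m a b) (m c d) = hdot H a c * hdot G b d.
Hypothesis m_dense : forall v (e : R), 0 < e -> exists s : seq (H * G),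
  hnorm (v - \sum_(p <- s) m p.1 p.2) < e.
Variables (A : op H) (bA : bounded_op A).

(* Making the right factors orthogonal to the first one splits the norm of a sum of simple
   tensors. *)
Lemma tensor_left_bound (M : R) : (forall a, hnorm (A a) <= M * hnorm a) -> 0 < M ->
  forall s : seq (H * G), hnorm (\sum_(p <- s) m (A p.1) p.2) <= M * hnorm (\sum_(p <- s) m p.1 p.2).
Proof.
move=> hM M0 s; have [n] := ubnP (size s); elim: n s => // n IH [|[x b] s] /= sn.
  by rewrite !big_nil !hnorm0 mulr0.
(* The coefficient of the projection onto b, equal to 0 by the division convention when b = 0. *)
pose c (p : H * G) : R[i] := hdot G p.2 b / hdot G b b.
pose s' := [seq (p.1, p.2 - c p *: b) | p <- s].
have ort p : hdot G (p.2 - c p *: b) b = 0.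
  have [b0|b0] := eqVneq (hdot G b b) 0.
    have -> : b = 0 by apply: ip_eq0; rewrite /ip b0.
    by rewrite hdot0r.
  by rewrite hdotBl hdotZl divfK // subrr.
(* The left factor collecting everything along b. It does not involve A, so one splitting serves
   both A and the identity. *)
pose y := x + \sum_(p <- s) c p *: p.1.
have m0l d : m 0 d = 0 by apply: (@addrI _ (m 0 d)); rewrite -mDl !addr0.
have split_sum (B : op H) : bounded_op B ->
    \sum_(p <- (x, b) :: s) m (B p.1) p.2 = \sum_(p <- s') m (B p.1) p.2 + m (B y) b.
  move=> bB; rewrite big_cons big_map /= /y (bopD bB) mDl [RHS]addrCA; congr (_ + _).
  rewrite (big_morph B (bopD bB) (bop0 bB)) (big_morph (m^~ b) (fun u v => mDl u v b) (m0l b)).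
  rewrite -big_split; apply: eq_bigr => p _ /=.
  by rewrite (bopZ bB) mZl -mZr -mDr subrK.
have ort_sum (B : op H) z : ip (\sum_(p <- s') m (B p.1) p.2) (m z b) = 0.
  rewrite /ip -[hdot _ _ _]/((applyr (hdot P) (m z b)) _) raddf_sum big_map big1 // => p _.
  by rewrite /applyr /= m_dot ort mulr0.
have nm d : ip (m d b) (m d b) = ip d d * ip b b.
  by rewrite /ip m_dot !hdot_uu -rmorphM.
have bI := @bounded_id R H.
have pyth (B : op H) : bounded_op B ->
   hnorm (\sum_(p <- (x, b) :: s) m (B p.1) p.2) ^+ 2 =
   hnorm (\sum_(p <- s') m (B p.1) p.2) ^+ 2 + hnorm (B y) ^+ 2 * hnorm b ^+ 2.
  move=> bB; rewrite (split_sum B bB) -!ipuu !(ipDl, ipDr) (ipC (m _ _)) !ort_sum nm.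
  by rewrite addr0 add0r.
rewrite -(@ler_pXn2r _ 2) ?nnegrE ?mulr_ge0 ?hnorm_ge0 ?(ltW M0) // exprMn.
rewrite (pyth A bA) (pyth id bI) mulrDr; apply: lerD.
  rewrite -exprMn ler_pXn2r ?nnegrE ?mulr_ge0 ?hnorm_ge0 ?(ltW M0) //.
  by apply: IH; rewrite size_map.
rewrite [leRHS]mulrA ler_wpM2r ?sqr_ge0 //.
by rewrite -exprMn ler_pXn2r ?nnegrE ?mulr_ge0 ?hnorm_ge0 ?(ltW M0).
Qed.

(** The abstract bilinear m allows a second use with the factors exchanged, so that both A tensor 1
    and 1 tensor B are obtained. *)
Lemma tensor_left_exists : exists Z : op P, bounded_op Z /\ forall a b, Z (m a b) = m (A a) b.
Proof.
have [M [M0 hM]] := bop_bound bA.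
pose Gr v w := exists s : seq (H * G), v = \sum_(p <- s) m p.1 p.2 /\ w = \sum_(p <- s) m (A p.1) p.2.
have [||v w [s [-> ->]]|Z [bZ hZ]] := @bounded_extension R P Gr M _ _ M0 _.
- move=> a v w v' w' [s [-> ->]] [s' [-> ->]].
  exists ([seq (a *: p.1, p.2) | p <- s] ++ s').
  rewrite !big_cat !big_map !scaler_sumr; split; congr (_ + _); apply: eq_bigr => p _ /=.
    by rewrite mZl.
  by rewrite (bopZ bA) mZl.
- move=> v e e0; have [s hs] := m_dense v e0.
  by exists (\sum_(p <- s) m p.1 p.2), (\sum_(p <- s) m (A p.1) p.2); split=> //; exists s.
- exact: tensor_left_bound.
exists Z; split=> // a b; apply: hZ; exists [:: (a, b)].
by rewrite !big_seq1.
Qed.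

End TensorLeft.

Section Tensor.
Variables (R : realType) (H G : hilbert R) (P : tensor_product H G).
Implicit Types (A C : op H) (B D : op G) (Z : op P).

Lemma tp_dense_seq (v : P) (e : R) : 0 < e -> exists s : seq (H * G),
  hnorm (v - \sum_(p <- s) tp_mul P p.1 p.2) < e.
Proof.
move=> e0; have /denseP/(_ v e e0)[w [n [c [t [ht ->]]]] hw] := tp_dense (t := P).
have h i : exists p : H * G, t i = tp_mul P p.1 p.2.
  by have [a [b ->]] := ht i; exists (a, b).
have [p hp] := choice h.
exists [seq (c i *: (p i).1, (p i).2) | i <- enum 'I_n].
rewrite big_map big_enum /=; move: hw; congr (hnorm (_ - _) < _); apply: eq_bigr => i _.
by rewrite hp linearZl_LR.
Qed.

Lemma optensor_exists A B : bounded_op A -> bounded_op B ->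
  exists Z, bounded_op Z /\ forall a b, Z (tp_mul P a b) = tp_mul P (A a) (B b).
Proof.
move=> bA bB.
have [||||a b c d||X [bX hX]] := @tensor_left_exists R H G P (tp_mul P) _ _ _ _ _ _ A bA.
- by move=> *; rewrite linearDl.
- by move=> *; rewrite linearDr.
- by move=> *; rewrite linearZl_LR.
- by move=> *; rewrite linearZr_LR.
- exact: tp_dot.
- exact: tp_dense_seq.
have [||||a b c d||Y [bY hY]] := @tensor_left_exists R G H P (fun b a => tp_mul P a b) _ _ _ _ _ _ B bB.
- by move=> *; rewrite linearDr.
- by move=> *; rewrite linearDl.
- by move=> *; rewrite linearZr_LR.
- by move=> *; rewrite linearZl_LR.
- by rewrite tp_dot mulrC.
- move=> v e e0; have [s hs] := tp_dense_seq v e0.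
  by exists [seq (p.2, p.1) | p <- s]; rewrite big_map.
exists (X \o Y); split; first exact: bounded_comp.
by move=> a b /=; rewrite hY hX.
Qed.

Lemma optensorP A B : bounded_op A -> bounded_op B ->
  bounded_op (optensor P A B) /\ forall a b, optensor P A B (tp_mul P a b) = tp_mul P (A a) (B b).
Proof. by move=> bA bB; exact: (getPex (optensor_exists bA bB)). Qed.

Lemma eq_on_tensors (Z Z' : op P) : bounded_op Z -> bounded_op Z' ->
  (forall a b, Z (tp_mul P a b) = Z' (tp_mul P a b)) -> Z = Z'.
Proof.
move=> bZ bZ' h; apply: funext => v.
have bD : bounded_op (Z - Z') by apply: bounded_sub.
have [_ _ cl] := subspace_ker bD.
have : (Z - Z') v = 0.
  apply: cl => e e0; have [s hs] := tp_dense_seq v e0.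
  exists (\sum_(p <- s) tp_mul P p.1 p.2) => //=.
  rewrite (big_morph _ (bopD bD) (bop0 bD)) big1 // => p _.
  by rewrite opaddE opoppE h subrr.
by rewrite opaddE opoppE => /eqP; rewrite subr_eq0 => /eqP.
Qed.

Lemma optensorE A B Z : bounded_op A -> bounded_op B -> bounded_op Z ->
  (forall a b, Z (tp_mul P a b) = tp_mul P (A a) (B b)) -> optensor P A B = Z.
Proof.
move=> bA bB bZ hZ; have [b h] := optensorP bA bB.
by apply: eq_on_tensors => // x y; rewrite h hZ.
Qed.

Lemma optensor_id : optensor P id id = id.
Proof. by apply: optensorE => //; apply: bounded_id. Qed.

Lemma optensor_comp A B C D : bounded_op A -> bounded_op B -> bounded_op C -> bounded_op D ->
  optensor P (A \o C) (B \o D) = optensor P A B \o optensor P C D.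
Proof.
move=> bA bB bC bD; have [b1 h1] := optensorP bA bB; have [b2 h2] := optensorP bC bD.
apply: optensorE; try exact: bounded_comp.
by move=> a b /=; rewrite h2 h1.
Qed.

Lemma hdot_on_tensors (x y : P) :
  (forall a b, hdot P (tp_mul P a b) x = hdot P (tp_mul P a b) y) -> x = y.
Proof.
move=> h; apply/eqP; rewrite -subr_eq0; apply/eqP/hnorm_eq0/le_anti.
rewrite hnorm_ge0 andbT; set z := x - y; apply: (@le0_of_small _ _ 1) => e e0.
have [s hs] := tp_dense_seq z e0; set v := \sum_(_ <- _) _ in hs.
have zv : ip v z = 0.
  rewrite /ip -[hdot _ _ _]/((applyr (hdot P) z) _) raddf_sum big1 // => p _.
  by rewrite /applyr /= hdotBr h subrr.
have := ip_le (z - v) z; rewrite ipDl ipNl zv subr0 ipuu.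
move: hs (hnorm_ge0 z); move: (hnorm (z - v)) (hnorm z) => a b; nra.
Qed.

Lemma adjoint_optensor A B A' B' : bounded_op A -> bounded_op B ->
  bounded_op A' -> bounded_op B' -> adjoint A A' -> adjoint B B' ->
  adjoint (optensor P A B) (optensor P A' B').
Proof.
move=> bA bB bA' bB' hA hB; have [bZ hZ] := optensorP bA bB.
have [bY hY] := adjP bZ.
suff -> : optensor P A' B' = adj (optensor P A B) by [].
apply: optensorE => // c d; apply: hdot_on_tensors => a b.
by rewrite -hY hZ !tp_dot hA hB.
Qed.

(** The root is the tensor product of the roots; exhibiting it gives positivity as well as the
    Hilbert-Schmidt factor needed for traces. *)
Lemma psd_optensor A B : bounded_op A -> bounded_op B -> psd A -> psd B ->
  exists C : op P, [/\ bounded_op C, selfadj C & optensor P A B = C \o C].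
Proof.
move=> bA bB pA pB.
have [bC pC CC] := opsqrtP bA pA; have [bD pD DD] := opsqrtP bB pB.
have /(psdP bC)[sC _] := pC; have /(psdP bD)[sD _] := pD.
exists (optensor P (opsqrt A) (opsqrt B)); split.
- by have [] := optensorP bC bD.
- exact: adjoint_optensor.
- by rewrite -optensor_comp // CC DD.
Qed.

End Tensor.

(** * Density operators *)

Section DensityOperators.
Variables (R : realType) (H : hilbert R).
Implicit Types (rho sigma tau : op H) (A B Y : op H).

Lemma density_parts rho : density rho ->
  [/\ bounded_op rho, psd rho, selfadj rho & pos rho].
Proof.
by move=> /densityP[br pr _]; have /(psdP br)[sr qr] := pr.
Qed.

Lemma density_has_tr rho Y : density rho -> bounded_op Y -> has_tr (rho \o Y) (tr (rho \o Y)).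
Proof.
move=> drho bY; have [br pr _ _] := density_parts drho.
have [bC pC CC] := opsqrtP br pr; have /(psdP bC)[sC _] := pC.
have hs : (hs2 (opsqrt rho) < +oo)%E by rewrite -etr_sqr // CC density_etr // ltry.
have := has_tr_trform bC sC hs bY; rewrite CC => h.
by rewrite (has_tr_tr h).
Qed.

Lemma density_convex (r : R) rho sigma : density rho -> density sigma -> 0 <= r <= 1 ->
  density ((1 - r)%:C%C *: rho + r%:C%C *: sigma).
Proof.
move=> dr ds /andP[r0 r1]; have [br pr sr qr] := density_parts dr.
have [bs ps ss qs] := density_parts ds.
have bD : bounded_op ((1 - r)%:C%C *: rho + r%:C%C *: sigma).
  by apply: bounded_add; apply: bounded_scale.
apply/densityP; split=> //.
  apply/psdP => //; split; first by apply: selfadj_add; apply: selfadj_scale.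
  by move=> u; rewrite opaddE !opscaleE ipDl !ipZl addr_ge0 // mulr_ge0 // subr_ge0.
have /densityP[_ _ hr] := dr; have /densityP[_ _ hs] := ds.
have := has_trD (has_trZ (a := (1 - r)%:C%C) hr) (has_trZ (a := r%:C%C) hs).
by rewrite !mulr1 -rmorphD /= subrK.
Qed.

(** The operator r (rho + sigma), of trace 2 r, dominates the difference and its opposite. *)
Lemma density_sub_satc (r : R) rho sigma : density rho -> density sigma -> 0 <= r ->
  satc (r%:C%C *: (rho - sigma)) /\ trnorm (r%:C%C *: (rho - sigma)) <= 2 * r.
Proof.
move=> dr ds r0; have [br pr sr qr] := density_parts dr.
have [bs ps ss qs] := density_parts ds.
pose D : op H := r%:C%C *: (rho + sigma).
have bD : bounded_op D by apply/bounded_scale/bounded_add.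
have sD : selfadj D by apply/selfadj_scale/selfadj_add.
have qD : pos D by move=> u; rewrite /D opscaleE opaddE ipZl ipDl mulr_ge0 // addr_ge0.
have eD : etr D = (2 * r)%:E.
  have /densityP[_ _ hr] := dr; have /densityP[_ _ hs] := ds.
  have pD : psd D by apply/psdP.
  rewrite (etr_has_tr pD (has_trZ (a := r%:C%C) (has_trD hr hs))).
  by congr (_%:E); rewrite Re_mul Re_add /=; ring.
have -> : 2 * r = fine (etr D) by rewrite eD.
apply: satc_dominated => //.
- by apply/bounded_scale/bounded_sub.
- by apply/selfadj_scale/selfadj_sub.
- by rewrite eD ltry.
- move=> u; rewrite !opscaleE !(opaddE, opoppE) !ipZl !(ipDl, ipNl) ler_wpM2l //.
  by have := qs u; lra.
- move=> u; rewrite !opscaleE !(opaddE, opoppE) !ipZl !(ipDl, ipNl) -mulrN ler_wpM2l //.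
  by have := qr u; lra.
Qed.

Lemma density_satc rho sigma : density rho -> density sigma -> satc (rho - sigma).
Proof.
by move=> dr ds; have [] := density_sub_satc dr ds ler01; rewrite scale1r.
Qed.

Lemma trnorm_sub_self rho : density rho -> trnorm (rho - rho) = 0.
Proof.
move=> dr; apply: le_anti; have [bX sX _] := density_satc dr dr.
rewrite trnorm_ge0 // andbT.
by have [_] := density_sub_satc dr dr (lexx 0); rewrite scale0r mulr0 subrr.
Qed.

(** Traces against rank-one projections give the quadratic form. Identities between predual maps are
    reduced to identities for [T] in this way. *)
Lemma psd_ext A B : bounded_op A -> bounded_op B -> psd A -> psd B ->
  (forall u, tr (A \o rank1 u u) = tr (B \o rank1 u u)) -> A = B.
Proof.
move=> bA bB pA pB h; have /(psdP bA)[sA _] := pA; have /(psdP bB)[sB _] := pB.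
by apply: quad_ext => // u; rewrite /ip -!tr_rank1 // h.
Qed.

Section Distance.
Variable C : set (op H).
Hypotheses (C_density : C `<=` density) (C_neq0 : C !=set0).

Lemma dist_lbound sigma : density sigma -> lbound [set trnorm (sigma - rho) | rho in C] 0.
Proof.
move=> ds _ [rho Crho <-]; have [bX sX _] := density_satc ds (C_density Crho).
exact: trnorm_ge0.
Qed.

Lemma dist_ge0 sigma : density sigma -> 0 <= dist sigma C.
Proof.
move=> ds; apply: lb_le_inf; last exact: dist_lbound.
by have [rho Crho] := C_neq0; exists (trnorm (sigma - rho)), rho.
Qed.

Lemma dist_le sigma rho : density sigma -> C rho -> dist sigma C <= trnorm (sigma - rho).
Proof.
by move=> ds Crho; apply: ge_inf; [exists 0; exact: dist_lbound|exists rho].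
Qed.

Lemma dist_triangle sigma tau : density sigma -> density tau ->
  dist sigma C <= trnorm (sigma - tau) + dist tau C.
Proof.
move=> ds dt; rewrite addrC -lerBlDr; apply: lb_le_inf.
  by have [rho Crho] := C_neq0; exists (trnorm (tau - rho)), rho.
move=> _ [rho Crho <-]; rewrite lerBlDr addrC.
apply: le_trans (dist_le ds Crho) _; rewrite (subr_split sigma rho tau).
by have [] := satc_add (density_satc ds dt) (density_satc dt (C_density Crho)).
Qed.

Lemma dist_lt_ex sigma (e : R) : dist sigma C < e -> density sigma ->
  exists2 rho, C rho & trnorm (sigma - rho) < e.
Proof.
move=> lt ds.
have hi : has_inf [set trnorm (sigma - rho) | rho in C].
  split; last by exists 0; exact: dist_lbound.
  by have [rho Crho] := C_neq0; exists (trnorm (sigma - rho)), rho.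
have [|_ [rho Crho <-] h] := inf_adherent (_ : 0 < e - dist sigma C) hi.
  by rewrite subr_gt0.
by exists rho => //; move: h; rewrite /dist; lra.
Qed.

End Distance.
End DensityOperators.

(** * The predual semigroup *)

Section Predual.
Variables (R : realType) (H G : hilbert R) (P : tensor_product H G).
Variables (Psi : op G) (hPsi : density Psi).
Variables (U : R -> op P) (hU : forall t, 0 <= t -> unitary (U t)).
Variables (E0 : op P -> op H) (hE0 : conditional_expectation Psi E0).
Variables (trG : op P -> op H) (htrG : partial_trace trG).
Variables (T : R -> op H -> op H) (hT : qds T).
Hypothesis hTU : forall t X, 0 <= t -> bounded_op X ->
     T t X = E0 (adj (U t) \o optensor P X id \o U t).

Local Notation S := (predual_sg trG U Psi).

(** The normalization of [E0] is read off at time 0, where [T] is the identity and [U 0] is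
    unitary. *)
Lemma cond_exp_id : E0 id = id.
Proof.
have bI := @bounded_id R H.
rewrite -[RHS](qds_0 hT bI) hTU // optensor_id; congr E0.
by have [_ + _] := hU (lexx 0); rewrite -[in LHS](compA (adj (U 0)) id (U 0)).
Qed.

(* The conditional expectation of the identity is the identity, which gives the
   tensor product of [rho] and [Psi] trace one. *)
Lemma density_optensor (rho : op H) : density rho -> exists C : op P,
  [/\ bounded_op C, selfadj C, optensor P rho Psi = C \o C & hs2 C = 1%:E].
Proof.
move=> dr; have [br pr _ _] := density_parts dr; have [bPsi pPsi _ _] := density_parts hPsi.
have [C [bC sC CC]] := psd_optensor P br bPsi pr pPsi.
exists C; split=> //.
have [_ /(_ rho)] := hE0 (@bounded_id R P).
rewrite cond_exp_id CC; have [tcr _ tr1] := dr => /(_ tcr).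
rewrite -[tr (rho \o id)]/(tr rho) tr1 -[tr (_ \o id)]/(tr (C \o C)) => e1.
have h1 : has_tr (C \o C) 1 by rewrite e1; apply: has_tr_nonzero; rewrite -e1 oner_eq0.
by rewrite -etr_sqr // (etr_has_tr (psd_sqr sC bC) h1).
Qed.

Section AtTime.
Variables (t : R) (t0 : 0 <= t) (rho : op H) (dr : density rho).

Let W := U t \o optensor P rho Psi \o adj (U t).

(** Conjugating the root C by the unitary gives a root D of the evolved state with the same
    Hilbert-Schmidt norm; hence that state is trace class and the partial trace identity applies to
    it. *)
Lemma predual_spec : exists C : op P,
  [/\ bounded_op C, selfadj C, hs2 C = 1%:E, optensor P rho Psi = C \o C &
   let D := U t \o C \o adj (U t) in
   [/\ bounded_op D, selfadj D, hs2 D = 1%:E, W = D \o D & trace_class W]].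
Proof.
have [C [bC sC CC hC]] := density_optensor dr; exists C; split=> // D.
have [bU U'U UU'] := hU t0; have [bU' aU] := adjP bU.
have bD : bounded_op D by apply: bounded_comp => //; apply: bounded_comp.
have sD : selfadj D.
  exact: (adjoint_comp (adjoint_comp aU sC) (adjoint_sym aU)).
have hD : hs2 D = 1%:E by rewrite hs2_conjugate.
have WD : W = D \o D.
  rewrite /W CC; apply: funext => x /=; congr (U t _); congr (C _).
  by have /= -> := congr1 (fun f => f (C (adj (U t) x))) U'U.
split=> //; rewrite WD; split; first exact: bounded_comp.
rewrite opabs_psd; [|exact: bounded_comp|exact: psd_sqr].
by rewrite etr_sqr // hD ltry.
Qed.

(** Both traces are convergent and equal to a [trform]; conjugation moves the unitaries onto the
    observable, where the conditional expectation applies. *)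
Lemma predual_duality (Y : op H) : bounded_op Y -> tr (S t rho \o Y) = tr (rho \o T t Y).
Proof.
move=> bY; have [C [bC sC hC CC [bD sD hD WD tcW]]] := predual_spec.
have [bU U'U UU'] := hU t0; have [bU' aU] := adjP bU.
have [_ /(_ Y bY) ->] := htrG tcW; rewrite -/W WD.
have bI := @bounded_id R G; have [bYI _] := optensorP P bY bI.
rewrite (has_tr_tr (has_tr_trform bD sD _ bYI)) ?hD ?ltry //.
rewrite (trform_unitary bC bYI bU bU' aU U'U UU').
have bZ : bounded_op (adj (U t) \o optensor P Y id \o U t).
  by apply: bounded_comp => //; apply: bounded_comp.
rewrite -(has_tr_tr (has_tr_trform bC sC _ bZ)) ?hC ?ltry // -CC hTU //.
by have [_ ->] := hE0 bZ; have [] := dr.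
Qed.

(** Positivity is tested on rank-one projections, whose tensor product with the identity is
    positive; the trace is the duality at the identity. *)
Lemma predual_density : density (S t rho).
Proof.
have [C [bC sC hC CC [bD sD hD WD tcW]]] := predual_spec.
have [tcS trS] := htrG tcW; have [bS _] := tcS.
split=> //.
  move=> u; rewrite -tr_rank1 // trS; last exact: bounded_rank1.
  rewrite -/W WD; have bI := @bounded_id R G.
  have bu := @bounded_rank1 R H u u; have [bYI _] := optensorP P bu bI.
  rewrite (has_tr_tr (has_tr_trform bD sD _ bYI)) ?hD ?ltry //.
  apply: trform_psd => //; first by rewrite hD ltry.
  have pI : psd (id : op G) by move=> x; rewrite hdot_uu ler0c ip_ge0.
  have [B [bB sB ->]] := psd_optensor P bu bI (psd_rank1 u) pI.
  exact: psd_sqr.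
rewrite -[tr _]/(tr (S t rho \o id)) trS; last exact: bounded_id.
rewrite optensor_id -[tr _]/(tr W) WD.
have eD := etr_sqr sD; rewrite hD in eD.
by rewrite (has_tr_tr (has_tr_psd (psd_sqr sD bD) eD)).
Qed.

End AtTime.

(** Inherited from the composition law of [T] through duality. *)
Lemma predual_semigroup (s t : R) (rho : op H) : 0 <= s -> 0 <= t -> density rho ->
  S (s + t) rho = S s (S t rho).
Proof.
move=> s0 t0 dr; have st0 : 0 <= s + t by rewrite addr_ge0.
have d1 := predual_density st0 dr; have dt := predual_density t0 dr.
have d2 := predual_density s0 dt.
have [b1 p1 _ _] := density_parts d1; have [b2 p2 _ _] := density_parts d2.
apply: psd_ext => // u; have bu := @bounded_rank1 R H u u.
have [hb _ _] := qds_bounded hT s0.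
rewrite !predual_duality //; last exact: hb.
(* Duality reverses the order of composition, so the times are exchanged before the law of [T] is
   used. *)
by rewrite addrC (qds_D hT).
Qed.

(** Linearity is not part of the description of [trG]; it is recovered by testing on rank-one
    projections, where both sides become traces against [T t]. *)
Lemma predual_affine (t r : R) (rho sigma : op H) : 0 <= t -> 0 <= r <= 1 ->
  density rho -> density sigma ->
  S t ((1 - r)%:C%C *: rho + r%:C%C *: sigma) = (1 - r)%:C%C *: S t rho + r%:C%C *: S t sigma.
Proof.
move=> t0 r01 dr ds; have dc := density_convex dr ds r01.
have dSr := predual_density t0 dr; have dSs := predual_density t0 ds.
have d1 := predual_density t0 dc; have d2 := density_convex dSr dSs r01.
have [b1 p1 _ _] := density_parts d1; have [b2 p2 _ _] := density_parts d2.
have mix (x y Y : op H) : density x -> density y -> bounded_op Y ->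
    tr (((1 - r)%:C%C *: x + r%:C%C *: y) \o Y) = (1 - r)%:C%C * tr (x \o Y) + r%:C%C * tr (y \o Y).
  move=> dx dy bY; apply: has_tr_tr.
  exact: has_trD (has_trZ (density_has_tr dx bY)) (has_trZ (density_has_tr dy bY)).
apply: psd_ext => // u; have bu := @bounded_rank1 R H u u.
have [hb _ _] := qds_bounded hT t0.
rewrite predual_duality // !mix //; last exact: hb.
by rewrite !predual_duality.
Qed.

End Predual.

(** * Local and global asymptotic stability *)

Section GlobalFromLocal.
Variables (R : realType) (H : hilbert R) (S : R -> op H -> op H) (C N : set (op H)).
Hypothesis S_density : forall t rho, 0 <= t -> density rho -> density (S t rho).
Hypothesis S_semigroup : forall s t rho, 0 <= s -> 0 <= t -> density rho -> S (s + t) rho = S s (S t rho).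
Hypothesis S_affine : forall t r rho sigma, 0 <= t -> 0 <= r <= 1 -> density rho -> density sigma ->
  S t ((1 - r)%:C%C *: rho + r%:C%C *: sigma) = (1 - r)%:C%C *: S t rho + r%:C%C *: S t sigma.
Hypotheses (C_density : C `<=` density) (C_neq0 : C !=set0) (hN : density_nbhd C N).

Let attracted rho := dist (S t rho) C @[t --> +oo] --> (0 : R).

Let attractedP rho : density rho -> attracted rho <->
  forall e : R, 0 < e -> exists2 t0, 0 <= t0 & forall t, t0 <= t -> dist (S t rho) C < e.
Proof.
move=> dr; split=> [/cvgrPdist_lt h e e0|h].
  (* The filter controls times strictly after M, hence M + 1; the maximum with 0 keeps times where
     distances are known to be nonnegative. *)
  have [M [_ hM]] := h e e0; exists (Num.max 0 (M + 1)); first by rewrite le_max lexx.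
  move=> t; rewrite ge_max => /andP[t0 Mt].
  have := hM t; rewrite sub0r normrN ger0_norm; last exact/(dist_ge0 C_density C_neq0)/S_density.
  by apply; apply: lt_le_trans Mt; rewrite ltrDl.
apply/cvgrPdist_lt => e e0; have [t0 t00 ht] := h e e0.
exists t0; split; first exact: num_real.
move=> t /ltW tt; rewrite sub0r normrN ger0_norm; first exact: ht.
by apply: dist_ge0 => //; apply: S_density => //; apply: le_trans tt.
Qed.

(** The uniform radius of the neighborhood lets a distance condition replace membership in N. *)
Let near_in_N : exists2 e : R, 0 < e & forall rho, density rho -> dist rho C < e -> N rho.
Proof.
have [_ _ [e e0 he]] := hN; exists e => // rho dr lt.
have [sigma Cs hs] := dist_lt_ex C_density C_neq0 lt dr.
by apply: (he _ Cs); split=> //; apply: ltW.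
Qed.

Let N_density : N `<=` density.
Proof. by have [_ [B [_ ->]] _] := hN => rho [b _ []]. Qed.

Lemma global_of_local : locally_asymptotically_stable S N C -> globally_asymptotically_stable S C.
Proof.
move=> [lyap [d d0 attr]]; have [e e0 inN] := near_in_N.
split=> [f f0|rho dr].
  have [g g0 hg] := lyap f f0; exists (Num.min g e); first by rewrite lt_min g0 e0.
  by move=> rho dr; rewrite lt_min => /andP[rg re]; apply: hg => //; apply: inN.
(* Below distance m a state lies both in N and within the attraction radius. *)
pose m := Num.min d e; have m0 : 0 < m by rewrite lt_min d0 e0.
have attr_near tau : density tau -> dist tau C < m -> attracted tau.
  by move=> dt; rewrite lt_min => /andP[td te]; apply: attr => //; apply: inN.
have step tau tau' : density tau -> density tau' -> attracted tau ->
    (forall t, 0 <= t -> trnorm (S t tau' - S t tau) <= m / 2) -> attracted tau'.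
  (* Half of m is for the first trajectory's distance at time t0, the other half for the gap between
     the trajectories. *)
  move=> dt dt' /(attractedP dt)/(_ (m / 2)) [|t0 t00 ht0]; first by rewrite divr_gt0.
  move=> close.
  have dS := S_density t00 dt; have dS' := S_density t00 dt'.
  have lt : dist (S t0 tau') C < m.
    have := dist_triangle C_density C_neq0 dS' dS.
    by have := close t0 t00; have := ht0 t0 (lexx _); lra.
  have /(attractedP dS') h := attr_near _ dS' lt.
  apply/(attractedP dt') => f f0; have [t1 t10 ht1] := h f f0.
  exists (t1 + t0); first by rewrite addr_ge0.
  move=> t tt; have t1t : t1 <= t - t0 by rewrite lerBrDr.
  (* After time t0 the trajectory of tau' is that of the attracted state S t0 tau'. *)
  rewrite -(subrK t0 t) S_semigroup //; first exact: ht1.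
  exact: le_trans t1t.
have [sigma Cs] := C_neq0; have ds := C_density Cs.
(* Consecutive trajectories differ by at most 2 / (n + 1), which has to stay within m / 2. *)
have [n hn] : exists n : nat, n.+1%:R^-1 < m / 4.
  by have [|n hn] := @exists_natSinv_lt R (m / 4); [rewrite divr_gt0|exists n; apply: hn].
set q := n.+1%:R^-1 in hn.
have q0 : 0 <= q by rewrite invr_ge0.
have qn : n.+1%:R * q = 1 by rewrite divff.
pose x (k : nat) : op H := (1 - k%:R * q)%:C%C *: sigma + (k%:R * q)%:C%C *: rho.
have r01 k : (k <= n.+1)%N -> 0 <= k%:R * q <= 1.
  move=> kn; apply/andP; split; first by rewrite mulr_ge0.
  by rewrite -[leRHS]qn; apply: ler_wpM2r => //; rewrite ler_nat.
suff h k : (k <= n.+1)%N -> attracted (x k).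
  by have := h n.+1 (leqnn _); rewrite /x qn subrr scale0r add0r scale1r.
elim: k => [_|k IH kn].
  rewrite /x mul0r subr0 scale1r scale0r addr0; apply: attr_near => //.
  apply: le_lt_trans m0; rewrite -(trnorm_sub_self ds).
  exact: dist_le.
have k1 := r01 _ (ltnW kn); have k2 := r01 _ kn.
have dk := density_convex ds dr k1; have dk1 := density_convex ds dr k2.
apply: step dk dk1 (IH (ltnW kn)) _ => t t0.
rewrite !S_affine //.
(* The increment is the same multiple of S t rho - S t sigma for every k, so its norm is at most 2 q
   uniformly in time. *)
have -> : (1 - k.+1%:R * q)%:C%C *: S t sigma + (k.+1%:R * q)%:C%C *: S t rho -
    ((1 - k%:R * q)%:C%C *: S t sigma + (k%:R * q)%:C%C *: S t rho) =
    q%:C%C *: (S t rho - S t sigma).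
  rewrite opprD addrACA -!scalerBl -!rmorphB /=.
  have -> : 1 - k.+1%:R * q - (1 - k%:R * q) = - q by rewrite -natr1; ring.
  have -> : k.+1%:R * q - k%:R * q = q by rewrite -natr1; ring.
  by rewrite rmorphN /= scaleNr scalerBr addrC.
have [_ le] := density_sub_satc (S_density t0 dr) (S_density t0 ds) q0.
by apply: le_trans le _; move: hn; lra.
Qed.

Lemma local_of_global : globally_asymptotically_stable S C -> locally_asymptotically_stable S N C.
Proof.
move=> [lyap attr]; split.
  move=> e e0; have [d d0 hd] := lyap e e0; exists d => // rho Nr.
  exact/hd/N_density.
by exists 1 => // rho Nr _; apply/attr/N_density.
Qed.

End GlobalFromLocal.

Theorem theorem11 (R : realType) (H : hilbert R)
  (st : statistics) (K : hilbert R) (G : fock_space st K)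
  (P : tensor_product H G)
  (Psi : op G) (hPsi : density Psi)
  (U : R -> op P) (hU : forall t, 0 <= t -> unitary (U t))
  (E0 : op P -> op H) (hE0 : conditional_expectation Psi E0)
  (trG : op P -> op H) (htrG : partial_trace trG)
  (T : R -> op H -> op H) (hT : qds T) (hTc : uniformly_continuous_sg T)
  (hTU : forall t X, 0 <= t -> bounded_op X ->
     T t X = E0 (adj (U t) \o optensor P X id \o U t))
  (hC0 : invariant_densities T !=set0)
  (hC1 : invariant_densities T `<` density)
  (N : set (op H)) (hN : density_nbhd (invariant_densities T) N) :
  globally_asymptotically_stable (predual_sg trG U Psi)
    (invariant_densities T) <->
  locally_asymptotically_stable (predual_sg trG U Psi) N
    (invariant_densities T).
Proof.
have C_density : invariant_densities T `<=` density by have [] := hC1.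
have S_density t rho : 0 <= t -> density rho -> density (predual_sg trG U Psi t rho).
  by move=> t0 dr; apply: (predual_density hPsi hU hE0 htrG hT hTU).
have S_semigroup := predual_semigroup hPsi hU hE0 htrG hT hTU.
have S_affine := predual_affine hPsi hU hE0 htrG hT hTU.
split; first exact: local_of_global.
exact: global_of_local.
Qed.
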